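(* Let $i\in\mathbb{N}_0$ and let $\alpha,\beta,\epsilon\in\mathbb{C}$. Then $$F^{1:1;2}_{1:0;1}\left[\begin{matrix}\alpha: & \epsilon\,; & \beta-\epsilon,\ 1+\alpha-2\beta+\epsilon+i\,;\\ \beta: & -\,; & 1+\alpha-\beta+\epsilon+i\,;\end{matrix}\ \tfrac12,\ \tfrac12\right] =\frac{2^{i+\alpha-2\beta+2\epsilon}\,\Gamma(\beta-\epsilon-i)\,\Gamma(1+\alpha-\beta+\epsilon+i)}{\Gamma(\beta-\epsilon)\,\Gamma(1+\alpha-2\beta+2\epsilon+i)}\sum_{r=0}^{i}(-1)^r\binom{i}{r}\frac{\Gamma\!\left(\epsilon-\beta+\frac{1+\alpha+i+r}{2}\right)}{\Gamma\!\left(\frac{1+\alpha-i+r}{2}\right)}$$ and $$F^{1:1;2}_{1:0;1}\left[\begin{matrix}\alpha: & \epsilon\,; & \beta-\epsilon,\ 1+\alpha-2\beta+\epsilon-i\,;\\ \beta: & -\,; & 1+\alpha-\beta+\epsilon-i\,;\end{matrix}\ \tfrac12,\ \tfrac12\right] =\frac{2^{-i+\alpha-2\beta+2\epsilon}\,\Gamma(1+\alpha-\beta+\epsilon-i)}{\Gamma(1+\alpha-2\beta+2\epsilon-i)}\sum_{r=0}^{i}\binom{i}{r}\frac{\Gamma\!\left(\epsilon-\beta+\frac{1+\alpha-i+r}{2}\right)}{\Gamma\!\left(\frac{1+\alpha-i+r}{2}\right)}.$$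
   Context: For $\lambda\in\mathbb{C}$ and $n\in\mathbb{N}_0$, $(\lambda)_0=1$ and $(\lambda)_n=\lambda(\lambda+1)\cdots(\lambda+n-1)$; $\Gamma$ is Euler's Gamma function and $\binom{i}{r}$ the binomial coefficient. The (generalized) Kampé de Fériet function is defined by $$F^{H:A;B}_{G:C;D}\left[\begin{matrix}(h_H): & (a_A)\,; & (b_B)\,;\\ (g_G): & (c_C)\,; & (d_D)\,;\end{matrix}\ x,\ y\right]=\sum_{m=0}^\infty\sum_{n=0}^\infty\frac{\prod_{j=1}^H(h_j)_{m+n}\prod_{j=1}^A(a_j)_m\prod_{j=1}^B(b_j)_n}{\prod_{j=1}^G(g_j)_{m+n}\prod_{j=1}^C(c_j)_m\prod_{j=1}^D(d_j)_n}\frac{x^m}{m!}\frac{y^n}{n!},$$ where a dash ''$-$'' denotes an empty list of parameters (empty products equal $1$). Parameters are tacitly assumed to be such that the double series converges, no denominator parameter is a non-positive integer, and all Gamma values appearing are finite. *)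

(* Defs.v *)
From Stdlib Require Import Reals List Arith Factorial.
From Coquelicot Require Import Coquelicot.
Open Scope C_scope.

Definition cexp (z : C) : C :=
  (exp (Re z) * cos (Im z), exp (Re z) * sin (Im z))%R.

Definition cpow (a : R) (w : C) : C := cexp (w * RtoC (ln a)).

Fixpoint poch (l : C) (n : nat) : C :=
  match n with
  | O => 1
  | S k => poch l k * (l + RtoC (INR k))
  end.

(** Euler's Gamma function on C, via Gauss' limit formula
    Gamma z = lim_{n -> oo} n! n^z / (z (z+1) ... (z+n)),
    valid for every z which is not a non-positive integer. *)
Definition Gamma_seq (z : C) (n : nat) : C :=
  RtoC (INR (fact n)) * cpow (INR n) z / poch z (S n).
(* limit of a complex sequence, taken componentwise (meaningful when it converges) *)
Definition clim_seq (u : nat -> C) : C :=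
  (real (Lim_seq (fun n => Re (u n))), real (Lim_seq (fun n => Im (u n))))%R.
Definition Gamma (z : C) : C := clim_seq (Gamma_seq z).

Definition poch_prod (ps : list C) (n : nat) : C :=
  fold_right (fun a acc => poch a n * acc) 1 ps.

Definition kdf_term (h a b g c d : list C) (x y : C) (m n : nat) : C :=
  poch_prod h (m + n) * poch_prod a m * poch_prod b n
  / (poch_prod g (m + n) * poch_prod c m * poch_prod d n)
  * (x ^ m / RtoC (INR (fact m))) * (y ^ n / RtoC (INR (fact n))).

Definition kdf_partial (h a b g c d : list C) (x y : C) (MN : nat * nat) : C :=
  sum_n (fun m => sum_n (fun n => kdf_term h a b g c d x y m n) (snd MN)) (fst MN).

(** The double series converges (Pringsheim sense: rectangular partial sums
    converge as M, N -> oo jointly) and its sum, i.e. the value of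
    F^{H:A;B}_{G:C;D}[(h):(a);(b);(g):(c);(d); x, y], is [L]. *)
Definition kdf_converges_to (h a b g c d : list C) (x y L : C) : Prop :=
  filterlim (kdf_partial h a b g c d x y) (filter_prod eventually eventually)
            (locally L).

Definition nonpos_int (z : C) : Prop := exists k : nat, z = RtoC (- INR k).

Definition cbinom (i r : nat) : C := RtoC (Binomial.C i r).

(* Main.v *)
Require Import Defs.
From Stdlib Require Import Reals List Factorial Lra Lia.
From Coquelicot Require Import Coquelicot.
Import ListNotations.
Open Scope C_scope.

(** Write b = beta - eps.  In both identities eps = d - b - c and beta = d - c, so the sum over
    an antidiagonal m + n = N is a Pfaff-Saalschütz sum, and the double series collapses to
    2F1(alpha, d - b; d; 1/2).

    For i = 0 this is Gauss' second summation theorem 2F1(A, B; (A + B + 1)/2; 1/2).  The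
    hypergeometric equation at 1/2 relates its values at (A, B) and (A + 2, B + 2); iterating,
    Euler's transformation turns the shifted series into a power of 2 times a series tending
    to 1, and Gauss' product formula for Gamma evaluates the limit.

    The step from i to i + 1 is one contiguous relation for each sign, matched by Pascal's rule
    on the right-hand side.  It may pass through poles of the third parameter, hence the series
    is divided by Gamma(d) throughout. *)

(** * Complex limits and series *)

(* [sum_n] has its type in a Coquelicot structure, which hides [C] from [ring] and [field]. *)
Ltac toC := match goal with |- @eq _ ?x ?y => change (@eq C x y) end.

(** The Gamma function enters only through Gauss' limit, so Gauss' theorem is obtained from
    asymptotics alone. In 2F1(A + 2k, B + 2k; G + 2k; 1/2) all parameters grow. Euler's
    transformation leaves the numerator parameters G - A and G - B, which do not depend on k, over
    the growing G + 2k; that is why the series tends to 1. The Pochhammer symbols that remain form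
    ratios of Gauss quotients, and splitting (B)_2k into its even and odd factors does the work of
    Legendre's duplication formula. The Pfaff-Saalschütz sum serves twice: along the antidiagonals
    of the double series, and as the coefficient identity behind Euler's transformation. The
    contiguous relations and the shift by 2 are proved by telescoping partial sums, which covers
    vanishing parameters and poles of the third parameter together with the generic case.
    Convergence always comes from a geometric majorant: the factor 1/2 per term dominates every
    polynomially growing quotient of Pochhammer symbols, and the ratio 3/4 leaves room for them. *)

Definition Clim (u : nat -> C) (l : C) : Prop :=
  is_lim_seq (fun n => Cmod (u n - l)) 0%R.

(** Balls of the product topology on [C] are squares, those of [Cmod] are discs; a square of radius
    r lies in the disc of radius sqrt 2 times r, hence the division by [sqrt 2]. *)
Lemma Clim_filterlim u l : filterlim u eventually (locally l) <-> Clim u l.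
Proof.
  split; intros H.
  - apply is_lim_seq_spec; intros e.
    assert (He : (0 < e / sqrt 2)%R)
      by (apply Rdiv_lt_0_compat; [apply cond_pos | apply Rlt_sqrt2_0]).
    generalize (proj1 (filterlim_locally u l) H (mkposreal _ He)).
    apply filter_imp; intros n Hn.
    apply (C_NormedModule_mixin_compat2 l (u n)) in Hn; simpl in Hn.
    rewrite Rminus_0_r, Rabs_pos_eq by apply Cmod_ge_0.
    replace (pos e) with (sqrt 2 * (e / sqrt 2))%R; [exact Hn|].
    field. apply Rgt_not_eq, Rlt_sqrt2_0.
  - apply filterlim_locally; intros e.
    generalize (proj2 (is_lim_seq_spec _ _) H e).
    apply filter_imp; intros n Hn.
    rewrite Rminus_0_r, Rabs_pos_eq in Hn by apply Cmod_ge_0.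
    now apply C_NormedModule_mixin_compat1.
Qed.

Lemma Clim_squeeze (u : nat -> C) (l : C) (b : nat -> R) (N : nat) :
  (forall n, (N <= n)%nat -> (Cmod (u n - l) <= b n)%R) ->
  is_lim_seq b 0%R -> Clim u l.
Proof.
  intros H Hb. unfold Clim.
  apply is_lim_seq_le_le_loc with (u := fun _ => 0%R) (w := b);
    [|apply is_lim_seq_const|exact Hb].
  exists N; intros n Hn; split; [apply Cmod_ge_0 | now apply H].
Qed.

Lemma Clim_const (l : C) : Clim (fun _ => l) l.
Proof.
  apply Clim_squeeze with (fun _ => 0%R) 0%nat; [|apply is_lim_seq_const].
  intros n _. replace (l - l) with (RtoC 0) by ring. rewrite Cmod_0; lra.
Qed.

Lemma Clim_ext_loc (N : nat) u v l :
  (forall n, (N <= n)%nat -> u n = v n) -> Clim u l -> Clim v l.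
Proof.
  intros H. apply is_lim_seq_ext_loc. exists N; intros n Hn. now rewrite H.
Qed.

Lemma Clim_ext u v l : (forall n, u n = v n) -> Clim u l -> Clim v l.
Proof. intros H; apply (Clim_ext_loc 0); auto. Qed.

Lemma Clim_unique u l m : Clim u l -> Clim u m -> l = m.
Proof.
  intros H K. apply Clim_filterlim in H, K.
  exact (filterlim_locally_unique u l m H K).
Qed.

Lemma Clim_plus (u v : nat -> C) (l m : C) :
  Clim u l -> Clim v m -> Clim (fun n => u n + v n) (l + m).
Proof.
  intros H K.
  apply Clim_squeeze with (fun n => Cmod (u n - l) + Cmod (v n - m))%R 0%nat.
  - intros n _. replace (u n + v n - (l + m)) with ((u n - l) + (v n - m)) by ring.
    apply Cmod_triangle.
  - replace (Finite 0) with (Finite (0 + 0)) by now rewrite Rplus_0_r.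
    now apply is_lim_seq_plus'.
Qed.

Lemma Clim_scal (k : C) (u : nat -> C) (l : C) : Clim u l -> Clim (fun n => k * u n) (k * l).
Proof.
  intros H. apply Clim_squeeze with (fun n => Cmod k * Cmod (u n - l))%R 0%nat.
  - intros n _. rewrite <- Cmod_mult. right. f_equal. ring.
  - replace (Finite 0) with (Rbar_mult (Cmod k) 0%R) by (simpl; f_equal; ring).
    now apply is_lim_seq_scal_l.
Qed.

Lemma Clim_minus (u v : nat -> C) (l m : C) :
  Clim u l -> Clim v m -> Clim (fun n => u n - v n) (l - m).
Proof.
  intros H K.
  apply Clim_ext with (fun n => u n + (-(1)) * v n); [intros; ring|].
  replace (l - m) with (l + -(1) * m) by ring.
  apply Clim_plus, Clim_scal; assumption.
Qed.

Lemma Clim_mult (u v : nat -> C) (l m : C) :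
  Clim u l -> Clim v m -> Clim (fun n => u n * v n) (l * m).
Proof.
  intros H K.
  apply Clim_squeeze with
    (fun n => Cmod (u n - l) * Cmod (v n - m)
              + (Cmod m * Cmod (u n - l) + Cmod l * Cmod (v n - m)))%R 0%nat.
  - intros n _.
    replace (u n * v n - l * m)
      with ((u n - l) * (v n - m) + (m * (u n - l) + l * (v n - m))) by ring.
    rewrite <- !Cmod_mult.
    eapply Rle_trans; [apply Cmod_triangle|].
    apply Rplus_le_compat_l, Cmod_triangle.
  - replace (Finite 0) with (Finite (0 * 0 + (Cmod m * 0 + Cmod l * 0)))
      by (f_equal; ring).
    apply is_lim_seq_plus'; [|apply is_lim_seq_plus'];
      apply is_lim_seq_mult'; trivial; apply is_lim_seq_const.
Qed.

Lemma Clim_inv (u : nat -> C) (l : C) : l <> 0 -> Clim u l -> Clim (fun n => / u n) (/ l).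
Proof.
  intros Hl H.
  assert (Pl : (0 < Cmod l)%R) by (apply (proj1 (Cmod_gt_0 l)); exact Hl).
  assert (P2 : (0 < Cmod l / 2)%R) by lra.
  destruct (proj2 (is_lim_seq_spec _ _) H (mkposreal _ P2))
    as [N HN]; simpl in HN.
  (* From [N] on, [u n] has modulus at least half that of [l], which gives the factor 2. *)
  apply Clim_squeeze with (fun n => 2 / (Cmod l * Cmod l) * Cmod (u n - l))%R N.
  - intros n Hn. specialize (HN n Hn).
    rewrite Rminus_0_r, Rabs_pos_eq in HN by apply Cmod_ge_0.
    assert (Hu : (Cmod l / 2 <= Cmod (u n))%R).
    { assert (Cmod l <= Cmod (u n) + Cmod (u n - l))%R; [|lra].
      rewrite <- (Cmod_opp (u n - l)).
      replace l with (u n + - (u n - l)) at 1 by ring. apply Cmod_triangle. }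
    assert (Hu0 : u n <> 0) by (apply (proj2 (Cmod_gt_0 _)); lra).
    replace (/ u n - / l) with (- ((u n - l) / (u n * l))) by (field; auto).
    rewrite Cmod_opp, Cmod_div, Cmod_mult by (now apply Cmult_neq_0).
    unfold Rdiv at 1. rewrite Rmult_comm.
    apply Rmult_le_compat_r; [apply Cmod_ge_0|].
    replace (2 / (Cmod l * Cmod l))%R with (/ ((Cmod l / 2) * Cmod l))%R by (field; lra).
    apply Rinv_le_contravar; [apply Rmult_lt_0_compat; lra|].
    apply Rmult_le_compat_r; lra.
  - replace (Finite 0) with (Rbar_mult (2 / (Cmod l * Cmod l))%R 0%R)
      by (simpl; f_equal; ring).
    now apply is_lim_seq_scal_l.
Qed.

Lemma Clim_subseq (phi : nat -> nat) u l :
  filterlim phi eventually eventually -> Clim u l -> Clim (fun n => u (phi n)) l.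
Proof. intros Hp H. exact (is_lim_seq_subseq _ _ phi Hp H). Qed.

Lemma Clim_incr_1 u l : Clim (fun n => u (S n)) l <-> Clim u l.
Proof. symmetry. exact (is_lim_seq_incr_1 (fun n => Cmod (u n - l)) 0%R). Qed.

Lemma im_le_Cmod (c : C) : (Rabs (Im c) <= Cmod c)%R.
Proof. eapply Rle_trans; [apply Rmax_r | apply Rmax_Cmod]. Qed.

Lemma Cmod_le_Re_Im (c : C) : (Cmod c <= Rabs (Re c) + Rabs (Im c))%R.
Proof.
  replace c with (RtoC (Re c) + Ci * RtoC (Im c)) at 1
    by (destruct c; unfold RtoC, Ci, Cmult, Cplus; simpl; f_equal; ring).
  eapply Rle_trans; [apply Cmod_triangle|].
  rewrite Cmod_mult, Cmod_Ci, !Cmod_R. lra.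
Qed.

Lemma is_lim_seq_dist_0 (u : nat -> R) (l : R) (b : nat -> R) :
  (forall n, (Rabs (u n - l) <= b n)%R) -> is_lim_seq b 0%R -> is_lim_seq u l.
Proof.
  intros H Hb.
  apply is_lim_seq_ext with (fun n => (u n - l) + l)%R; [intros; ring|].
  replace (Finite l) with (Finite (0 + l)) by (f_equal; ring).
  apply is_lim_seq_plus'; [|apply is_lim_seq_const].
  apply is_lim_seq_abs_0.
  apply is_lim_seq_le_le with (fun _ => 0%R) b; [|apply is_lim_seq_const|exact Hb].
  intros n; split; [apply Rabs_pos | apply H].
Qed.

Lemma Clim_components u l :
  Clim u l <-> is_lim_seq (fun n => Re (u n)) (Re l) /\ is_lim_seq (fun n => Im (u n)) (Im l).
Proof.
  split.
  - intros H; split; apply is_lim_seq_dist_0 with (fun n => Cmod (u n - l)); trivial;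
      intros n.
    + exact (re_le_Cmod (u n - l)).
    + exact (im_le_Cmod (u n - l)).
  - intros [H K].
    apply Clim_squeeze with
      (fun n => Rabs (Re (u n) - Re l) + Rabs (Im (u n) - Im l))%R 0%nat.
    + intros n _. exact (Cmod_le_Re_Im (u n - l)).
    + replace (Finite 0) with (Finite (Rabs (Re l - Re l) + Rabs (Im l - Im l)))
        by (f_equal; rewrite !Rminus_diag_eq, Rabs_R0 by trivial; ring).
      apply is_lim_seq_plus'; apply (is_lim_seq_abs _ (Finite _)), is_lim_seq_minus'; trivial;
        apply is_lim_seq_const.
Qed.

Lemma clim_seq_unique u l : Clim u l -> clim_seq u = l.
Proof.
  intros H. apply Clim_components in H as [H K]. unfold clim_seq.
  rewrite (is_lim_seq_unique _ _ H), (is_lim_seq_unique _ _ K). now destruct l.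
Qed.

Definition Cser (a : nat -> C) (l : C) : Prop := Clim (sum_n a) l.

Lemma Cser_dominated (a : nat -> C) (b : nat -> R) :
  (forall n, (Cmod (a n) <= b n)%R) -> ex_series b -> Cser a (clim_seq (sum_n a)).
Proof.
  intros H Hb.
  destruct (ex_series_le (V := C_CompleteNormedModule) a b H Hb) as [l Hl].
  apply (Clim_filterlim (sum_n a) l) in Hl. unfold Cser.
  now rewrite (clim_seq_unique _ _ Hl).
Qed.

Lemma Csum_S (a : nat -> C) n : sum_n a (S n) = sum_n a n + a (S n).
Proof. now rewrite sum_Sn. Qed.

Lemma Csum_0 (a : nat -> C) : sum_n a 0 = a 0%nat.
Proof. now rewrite sum_O. Qed.

Lemma Csum_ext (a b : nat -> C) n :
  (forall k, (k <= n)%nat -> a k = b k) -> sum_n a n = sum_n b n.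
Proof. intros H; now apply sum_n_ext_loc. Qed.

Lemma Csum_plus (a b : nat -> C) n : sum_n (fun k => a k + b k) n = sum_n a n + sum_n b n.
Proof. induction n; [now rewrite !Csum_0|]. rewrite !Csum_S, IHn; toC; ring. Qed.

Lemma Csum_scal (c : C) (a : nat -> C) n : sum_n (fun k => c * a k) n = c * sum_n a n.
Proof. induction n; [now rewrite !Csum_0|]. rewrite !Csum_S, IHn; toC; ring. Qed.

Lemma Csum_Cmod (a : nat -> C) (b : nat -> R) n :
  (forall k, (k <= n)%nat -> (Cmod (a k) <= b k)%R) -> (Cmod (sum_n a n) <= sum_n b n)%R.
Proof.
  induction n; intros H.
  - rewrite Csum_0, sum_O. apply H; lia.
  - rewrite Csum_S, sum_Sn. eapply Rle_trans; [apply Cmod_triangle|].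
    apply Rplus_le_compat; [apply IHn; intros; apply H; lia | apply H; lia].
Qed.

Lemma Cser_ext a b l : (forall n, a n = b n) -> Cser a l -> Cser b l.
Proof. intros H. apply Clim_ext. intros n; apply Csum_ext; auto. Qed.

Lemma Cser_plus (a b : nat -> C) (l m : C) :
  Cser a l -> Cser b m -> Cser (fun n => a n + b n) (l + m).
Proof.
  intros H K. apply Clim_ext with (fun n => sum_n a n + sum_n b n).
  - intros; now rewrite Csum_plus.
  - now apply Clim_plus.
Qed.

Lemma Cser_scal (k : C) (a : nat -> C) (l : C) : Cser a l -> Cser (fun n => k * a n) (k * l).
Proof.
  intros H. apply Clim_ext with (fun n => k * sum_n a n).
  - intros; now rewrite Csum_scal.
  - now apply Clim_scal.
Qed.

Lemma Cser_unique a l m : Cser a l -> Cser a m -> l = m.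
Proof. apply Clim_unique. Qed.

Lemma RtoC_INR_S n : RtoC (INR (S n)) = RtoC (INR n) + 1.
Proof. now rewrite S_INR, RtoC_plus. Qed.

Lemma RtoC_neq_0 (x : R) : x <> 0%R -> RtoC x <> 0.
Proof. intros H E; apply H. now injection E. Qed.

Lemma RtoC_fact_neq_0 n : RtoC (INR (fact n)) <> 0.
Proof. apply RtoC_neq_0, INR_fact_neq_0. Qed.

Lemma RtoC_fact_S n : RtoC (INR (fact (S n))) = (RtoC (INR n) + 1) * RtoC (INR (fact n)).
Proof. rewrite <- RtoC_INR_S, <- RtoC_mult, <- mult_INR. reflexivity. Qed.

Lemma RtoC_INR_S_neq_0 n : RtoC (INR n) + 1 <> 0.
Proof. rewrite <- RtoC_INR_S. apply RtoC_neq_0, not_0_INR. lia. Qed.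

Lemma Cinv_neq_0 (z : C) : z <> 0 -> / z <> 0.
Proof. intros H E. apply C1_nz. rewrite <- (Cinv_r z H), E. ring. Qed.

Lemma Cdiv_neq_0 (z w : C) : z <> 0 -> w <> 0 -> z / w <> 0.
Proof. intros H K. apply Cmult_neq_0; trivial. now apply Cinv_neq_0. Qed.

(** * Complex powers *)

Lemma cexp_plus z w : cexp (z + w) = cexp z * cexp w.
Proof.
  destruct z, w. unfold cexp, Cmult, Cplus; simpl. rewrite exp_plus, cos_plus, sin_plus. f_equal; ring.
Qed.

Lemma cexp_0 : cexp 0 = 1.
Proof. unfold cexp; simpl. rewrite exp_0, cos_0, sin_0. unfold RtoC; f_equal; ring. Qed.

Lemma cexp_neq_0 z : cexp z <> 0.
Proof.
  intros H. apply C1_nz. rewrite <- cexp_0.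
  replace (RtoC 0) with (z + - z) by ring. rewrite cexp_plus, H. ring.
Qed.

Lemma cexp_opp z : cexp (- z) = / cexp z.
Proof.
  assert (H : cexp z * cexp (- z) = 1)
    by (rewrite <- cexp_plus, <- cexp_0; f_equal; ring).
  pose proof (cexp_neq_0 z).
  replace (cexp (- z)) with (/ cexp z * (cexp z * cexp (- z))) by (field; trivial).
  rewrite H. field; trivial.
Qed.

Lemma cexp_RtoC (x : R) : cexp (RtoC x) = RtoC (exp x).
Proof. unfold cexp; simpl. rewrite cos_0, sin_0. unfold RtoC; f_equal; ring. Qed.

Lemma cpow_plus a z w : cpow a (z + w) = cpow a z * cpow a w.
Proof. unfold cpow. rewrite <- cexp_plus. f_equal; ring. Qed.

Lemma cpow_opp a z : cpow a (- z) = / cpow a z.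
Proof. unfold cpow. rewrite <- cexp_opp. f_equal; ring. Qed.

Lemma cpow_neq_0 a z : cpow a z <> 0.
Proof. apply cexp_neq_0. Qed.

Lemma cpow_1 (a : R) : (0 < a)%R -> cpow a 1 = RtoC a.
Proof. intros H. unfold cpow. rewrite Cmult_1_l, cexp_RtoC, exp_ln; trivial. Qed.

Lemma Clim_cexp_scal (z : C) (x : nat -> R) (l : R) :
  is_lim_seq x l -> Clim (fun n => cexp (z * RtoC (x n))) (cexp (z * RtoC l)).
Proof.
  intros H. apply Clim_components. destruct z as [a b]. unfold cexp; simpl. split.
  - apply (is_lim_seq_continuous
      (fun y => exp (a * y - b * 0) * cos (a * 0 + b * y))%R); trivial.
    apply derivable_continuous_pt, ex_derive_Reals_0. auto_derive; trivial.
  - apply (is_lim_seq_continuous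
      (fun y => exp (a * y - b * 0) * sin (a * 0 + b * y))%R); trivial.
    apply derivable_continuous_pt, ex_derive_Reals_0. auto_derive; trivial.
Qed.

Lemma sin_abs_le (x : R) : (Rabs (sin x) <= Rabs x)%R.
Proof.
  destruct (MVT_gen sin 0 x cos) as [c [_ Hc]].
  - intros y _. auto_derive; trivial; ring.
  - intros y _. apply continuity_sin.
  - rewrite sin_0, !Rminus_0_r in Hc. rewrite Hc, Rabs_mult.
    rewrite <- (Rmult_1_l (Rabs x)) at 2.
    apply Rmult_le_compat_r; [apply Rabs_pos|].
    apply Rabs_le, COS_bound.
Qed.

Lemma between_abs (x c : R) : (Rmin 0 x <= c <= Rmax 0 x)%R -> (Rabs c <= Rabs x)%R.
Proof.
  unfold Rmin, Rmax. destruct (Rle_dec 0 x); intros H.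
  - rewrite !Rabs_pos_eq; lra.
  - rewrite !Rabs_left1; lra.
Qed.

Lemma cos_minus_1_abs_le (x : R) : (Rabs (cos x - 1) <= x ^ 2)%R.
Proof.
  destruct (MVT_gen cos 0 x (fun y => - sin y)%R) as [c [Hc1 Hc]].
  - intros y _. auto_derive; trivial; ring.
  - intros y _. apply continuity_cos.
  - rewrite cos_0, !Rminus_0_r in Hc. rewrite Hc, Rabs_mult, Rabs_Ropp, <- (pow2_abs x).
    simpl; rewrite Rmult_1_r.
    apply Rmult_le_compat_r; [apply Rabs_pos|].
    eapply Rle_trans; [apply sin_abs_le | now apply between_abs].
Qed.

Lemma sin_minus_id_abs_le (x : R) : (Rabs (sin x - x) <= 2 * x ^ 2)%R.
Proof.
  destruct (MVT_gen (fun y => sin y - y)%R 0 x (fun y => cos y - 1)%R) as [c [Hc1 Hc]].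
  - intros y _. auto_derive; trivial; ring.
  - intros y _. apply continuity_pt_minus; [apply continuity_sin|].
    apply derivable_continuous_pt, derivable_pt_id.
  - rewrite sin_0, !Rminus_0_r in Hc. rewrite Hc, Rabs_mult, <- (pow2_abs x).
    simpl; rewrite Rmult_1_r, <- Rmult_assoc.
    apply Rmult_le_compat_r; [apply Rabs_pos|].
    pose proof (between_abs x c Hc1). pose proof (cos_minus_1_abs_le c) as H1.
    rewrite <- pow2_abs in H1. pose proof (COS_bound c). pose proof (Rabs_pos c).
    assert (Rabs (cos c - 1) <= 2)%R by (apply Rabs_le; lra).
    (* For |c| <= 1 the bound c^2 is at most |c|; beyond that the trivial bound 2 is below 2 |c|. *)
    destruct (Rle_dec (Rabs c) 1); nra.
Qed.

Lemma exp_le_mono (x y : R) : (x <= y)%R -> (exp x <= exp y)%R.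
Proof.
  intros [H|H]; [left; now apply exp_increasing | right; now rewrite H].
Qed.

Lemma exp_minus_1_abs_le (x : R) : (Rabs (exp x - 1) <= Rabs x * exp (Rabs x))%R.
Proof.
  pose proof (exp_ineq1_le x). pose proof (exp_ineq1_le (- x)) as H1.
  rewrite exp_Ropp in H1. pose proof (exp_pos x).
  assert (Hx : (exp x - 1 <= x * exp x)%R).
  { apply Rmult_le_compat_l with (r := exp x) in H1; [|lra].
    rewrite Rinv_r in H1 by lra. nra. }
  destruct (Rle_dec 0 x).
  - rewrite !(Rabs_pos_eq x) by lra. rewrite Rabs_pos_eq by lra. lra.
  - rewrite (Rabs_left1 x) by lra. rewrite Rabs_left1 by nra.
    pose proof (exp_ineq1_le (- x)). nra.
Qed.

Lemma exp_taylor1_abs_le (x : R) : (Rabs (exp x - 1 - x) <= x ^ 2 * exp (Rabs x))%R.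
Proof.
  pose proof (exp_ineq1_le x). pose proof (exp_ineq1_le (- x)) as H1.
  rewrite exp_Ropp in H1. pose proof (exp_pos x).
  assert (Hx : (exp x - 1 <= x * exp x)%R).
  { apply Rmult_le_compat_l with (r := exp x) in H1; [|lra].
    rewrite Rinv_r in H1 by lra. nra. }
  rewrite Rabs_pos_eq by lra.
  pose proof (exp_minus_1_abs_le x).
  assert (exp x - 1 - x <= Rabs x * Rabs (exp x - 1))%R.
  { rewrite <- Rabs_mult. eapply Rle_trans; [|apply Rle_abs]. lra. }
  rewrite <- pow2_abs. pose proof (Rabs_pos x). nra.
Qed.

(** The constant 5 is 1 + 1 + 2 + 1, the shares of the pieces [A1] to [A4] of the real and imaginary
    parts. The quadratic remainder is what makes the steps of Gauss' product summable. *)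
Lemma cexp_taylor1 (w : C) :
  (Cmod (cexp w - 1 - w) <= 5 * exp (Cmod w) * Cmod w ^ 2)%R.
Proof.
  destruct w as [x y]. set (m := Cmod (x, y)).
  assert (Hx : (Rabs x <= m)%R) by exact (re_le_Cmod (x, y)).
  assert (Hy : (Rabs y <= m)%R) by exact (im_le_Cmod (x, y)).
  assert (He : (exp (Rabs x) <= exp m)%R) by now apply exp_le_mono.
  assert (Hex : (exp x <= exp m)%R)
    by (apply exp_le_mono; pose proof (Rle_abs x); lra).
  pose proof (exp_pos x). pose proof (exp_pos (Rabs x)).
  pose proof (Rabs_pos x). pose proof (Rabs_pos y).
  assert (Hx2 : (x ^ 2 <= m ^ 2)%R) by (rewrite <- pow2_abs; nra).
  assert (Hy2 : (y ^ 2 <= m ^ 2)%R) by (rewrite <- (pow2_abs y); nra).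
  assert (Hxy : (Rabs x * Rabs y <= m ^ 2)%R) by nra.
  assert (0 <= m ^ 2)%R by apply pow2_ge_0.
  eapply Rle_trans; [apply Cmod_le_Re_Im|].
  unfold cexp, Cminus, Cplus, Copp, RtoC; simpl Re; simpl Im.
  replace (exp x * cos y + - (1) + - x)%R
    with (exp x * (cos y - 1) + (exp x - 1 - x))%R by ring.
  replace (exp x * sin y + - 0 + - y)%R
    with (exp x * (sin y - y) + (exp x - 1) * y)%R by ring.
  assert (A1 : (Rabs (exp x * (cos y - 1)) <= exp m * m ^ 2)%R).
  { rewrite Rabs_mult, (Rabs_pos_eq (exp x)) by lra.
    pose proof (cos_minus_1_abs_le y).
    apply Rmult_le_compat; try lra; apply Rabs_pos. }
  assert (A2 : (Rabs (exp x - 1 - x) <= exp m * m ^ 2)%R).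
  { pose proof (exp_taylor1_abs_le x). pose proof (pow2_ge_0 x).
    eapply Rle_trans; [eassumption|]. rewrite Rmult_comm.
    apply Rmult_le_compat; lra. }
  assert (A3 : (Rabs (exp x * (sin y - y)) <= exp m * (2 * m ^ 2))%R).
  { rewrite Rabs_mult, (Rabs_pos_eq (exp x)) by lra.
    pose proof (sin_minus_id_abs_le y).
    apply Rmult_le_compat; try lra; apply Rabs_pos. }
  assert (A4 : (Rabs ((exp x - 1) * y) <= exp m * m ^ 2)%R).
  { rewrite Rabs_mult. pose proof (exp_minus_1_abs_le x).
    apply Rle_trans with (Rabs x * exp (Rabs x) * Rabs y)%R;
      [now apply Rmult_le_compat_r|].
    replace (Rabs x * exp (Rabs x) * Rabs y)%R
      with (exp (Rabs x) * (Rabs x * Rabs y))%R by ring.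
    apply Rmult_le_compat; nra. }
  pose proof (Rabs_triang (exp x * (cos y - 1)) (exp x - 1 - x)).
  pose proof (Rabs_triang (exp x * (sin y - y)) ((exp x - 1) * y)). lra.
Qed.

Lemma is_lim_seq_inv_INR (k : nat) : is_lim_seq (fun n => / (INR n + INR (S k)))%R 0%R.
Proof.
  apply is_lim_seq_ext with (fun n => / INR (n + S k))%R; [intros; now rewrite plus_INR|].
  apply (is_lim_seq_incr_n (fun n => / INR n)%R (S k) 0%R).
  replace (Finite 0) with (Rbar_inv p_infty) by reflexivity.
  apply is_lim_seq_inv; [apply is_lim_seq_INR | discriminate].
Qed.

(** * Sequences whose relative increments are O(1/n^2) *)

Section SlowProduct.
Variables (u : nat -> C) (K : R).
Hypothesis K_ge0 : (0 <= K)%R.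
Hypothesis u_slow : forall n,
  (Cmod (u (S n) - u n) <= K * (/ (INR n + 1) - / (INR n + 2)) * Cmod (u n))%R.

(** The bound K / ((n + 1)(n + 2)) is kept as a difference so that its sums telescope. *)
Let e (n : nat) : R := (K * (/ (INR n + 1) - / (INR n + 2)))%R.

Lemma slow_step_ge0 n : (0 <= e n)%R.
Proof.
  unfold e. apply Rmult_le_pos; trivial. pose proof (pos_INR n).
  assert (/ (INR n + 2) <= / (INR n + 1))%R by (apply Rinv_le_contravar; lra). lra.
Qed.

(** Each step multiplies the modulus by at most 1 + [e n] <= exp ([e n]), and the exponents
    telescope to less than [K]. *)
Lemma slow_bounded n : (Cmod (u n) <= Cmod (u 0%nat) * exp K)%R.
Proof.
  apply Rle_trans with (Cmod (u 0%nat) * exp (K * (1 - / (INR n + 1))))%R.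
  - induction n as [|n IH].
    + simpl. replace (K * (1 - / (0 + 1)))%R with 0%R by field. rewrite exp_0; lra.
    + assert (H : (Cmod (u (S n)) <= Cmod (u n) * exp (e n))%R).
      { apply Rle_trans with (Cmod (u n) * (1 + e n))%R.
        - pose proof (Cmod_triangle (u n) (u (S n) - u n)) as H.
          replace (u n + (u (S n) - u n)) with (u (S n)) in H by ring.
          pose proof (u_slow n) as H1. fold (e n) in H1. lra.
        - apply Rmult_le_compat_l; [apply Cmod_ge_0 | apply exp_ineq1_le]. }
      eapply Rle_trans; [exact H|].
      eapply Rle_trans; [apply Rmult_le_compat_r; [left; apply exp_pos | exact IH]|].
      rewrite Rmult_assoc, <- exp_plus. right. do 2 f_equal.
      unfold e. rewrite S_INR. pose proof (pos_INR n). field. lra.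
  - apply Rmult_le_compat_l; [apply Cmod_ge_0|]. apply exp_le_mono.
    rewrite <- (Rmult_1_r K) at 2. apply Rmult_le_compat_l; trivial.
    pose proof (pos_INR n). assert (0 < / (INR n + 1))%R by (apply Rinv_0_lt_compat; lra). lra.
Qed.

Lemma slow_telescope n : sum_n e n = (K * (1 - / (INR n + 2)))%R.
Proof.
  induction n as [|n IH].
  - rewrite sum_O. unfold e. simpl. field.
  - rewrite sum_Sn, IH. unfold plus, e; simpl plus.
    change (K * (1 - / (INR n + 2)) + K * (/ (INR (S n) + 1) - / (INR (S n) + 2)) =
            K * (1 - / (INR (S n) + 2)))%R.
    rewrite S_INR. pose proof (pos_INR n). field. lra.
Qed.

Lemma slow_summable : ex_series e.
Proof.
  exists K. change (is_lim_seq (sum_n e) K). apply is_lim_seq_ext with (fun n => K * (1 - / (INR n + 2)))%R;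
    [intros; now rewrite slow_telescope|].
  replace (Finite K) with (Finite (K * (1 - 0))) by (f_equal; ring).
  apply is_lim_seq_mult'; [apply is_lim_seq_const|].
  apply is_lim_seq_minus'; [apply is_lim_seq_const | apply (is_lim_seq_inv_INR 1)].
Qed.

Lemma slow_converges : Clim u (clim_seq u).
Proof.
  assert (H : exists l, Clim u l).
  { exists (u 0%nat + clim_seq (sum_n (fun n => u (S n) - u n))).
    apply Clim_incr_1.
    apply Clim_ext with (fun n => u 0%nat + sum_n (fun n => u (S n) - u n) n).
    - intros n. induction n as [|n IH]; [rewrite Csum_0; ring|].
      rewrite Csum_S, Cplus_assoc, IH. toC; ring.
    - apply Clim_plus; [apply Clim_const|].
      apply Cser_dominated with (fun n => Cmod (u 0%nat) * exp K * e n)%R.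
      + intros n. eapply Rle_trans; [apply u_slow|]. fold (e n). rewrite Rmult_comm.
        apply Rmult_le_compat_r; [apply slow_step_ge0 | apply slow_bounded].
      + exact (ex_series_scal (V := R_NormedModule) (Cmod (u 0%nat) * exp K)%R e slow_summable). }
  destruct H as [l H]. now rewrite (clim_seq_unique _ _ H).
Qed.

(** A product of factors 1 - e_n is at least 1 minus the sum of the e_n. Starting at an [N] for
    which the remaining sum is at most 1/2, the modulus never falls below half of its value at
    [N]. *)
Lemma slow_limit_neq_0 : (forall n, u n <> 0) -> clim_seq u <> 0.
Proof.
  intros Hu H0. pose proof slow_converges as H. rewrite H0 in H.
  destruct (nfloor_ex (2 * K)) as [N [_ HN]]; [lra|].
  pose proof (pos_INR N) as PN.
  assert (HK : (K * / (INR N + 1) <= 1 / 2)%R).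
  { apply Rmult_le_reg_r with (INR N + 1)%R; [lra|].
    rewrite Rmult_assoc, Rinv_l by lra. lra. }
  assert (Hlow : forall j,
    (Cmod (u N) * (1 - (K * / (INR N + 1) - K * / (INR (N + j) + 1))) <= Cmod (u (N + j)%nat))%R).
  { induction j as [|j IH].
    - rewrite Nat.add_0_r. lra.
    - rewrite Nat.add_succ_r.
      set (n := (N + j)%nat) in *.
      assert (Hn : (INR N <= INR n)%R) by (apply le_INR; unfold n; lia).
      assert (K1 : (K * / (INR n + 1) <= K * / (INR N + 1))%R)
        by (apply Rmult_le_compat_l; trivial; apply Rinv_le_contravar; lra).
      assert (K2 : (0 <= K * / (INR n + 2))%R)
        by (apply Rmult_le_pos; trivial; left; apply Rinv_0_lt_compat; lra).
      pose proof (u_slow n) as H1. fold (e n) in H1. pose proof (slow_step_ge0 n) as He.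
      assert (H2 : (Cmod (u n) * (1 - e n) <= Cmod (u (S n)))%R).
      { pose proof (Cmod_triangle (u (S n)) (- (u (S n) - u n))) as H2.
        replace (u (S n) + - (u (S n) - u n)) with (u n) in H2 by ring.
        rewrite Cmod_opp in H2. lra. }
      eapply Rle_trans; [|exact H2].
      assert (E : e n = (K * / (INR n + 1) - K * / (INR n + 2))%R) by (unfold e; ring).
      rewrite S_INR. replace (INR n + 1 + 1)%R with (INR n + 2)%R by ring.
      pose proof (Cmod_ge_0 (u N)).
      eapply Rle_trans; [|apply Rmult_le_compat_r; [lra | exact IH]].
      rewrite Rmult_assoc. apply Rmult_le_compat_l; trivial.
      rewrite E in *. nra. }
  assert (HuN : (0 < Cmod (u N))%R) by apply (proj1 (Cmod_gt_0 _) (Hu N)).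
  assert (P2 : (0 < Cmod (u N) / 2)%R) by lra.
  destruct (proj2 (is_lim_seq_spec _ _) H (mkposreal _ P2)) as [M HM]; simpl in HM.
  specialize (HM (N + M)%nat ltac:(lia)). specialize (Hlow M).
  replace (u (N + M)%nat - 0) with (u (N + M)%nat) in HM by ring.
  rewrite Rminus_0_r, Rabs_pos_eq in HM by apply Cmod_ge_0.
  assert (0 <= K * / (INR (N + M) + 1))%R.
  { apply Rmult_le_pos; trivial. left; apply Rinv_0_lt_compat.
    pose proof (pos_INR (N + M)). lra. }
  nra.
Qed.
End SlowProduct.

(** * The reciprocal Gamma function *)

Lemma nonpos_int_shift z n : ~ nonpos_int z -> z + RtoC (INR n) <> 0.
Proof.
  intros H E. apply H. exists n. rewrite RtoC_opp.
  replace z with ((z + RtoC (INR n)) - RtoC (INR n)) by ring. rewrite E. ring.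
Qed.

Lemma nonpos_int_plus z n : ~ nonpos_int z -> ~ nonpos_int (z + RtoC (INR n)).
Proof.
  intros H [k Hk]. apply H. exists (k + n)%nat.
  replace z with ((z + RtoC (INR n)) - RtoC (INR n)) by ring. rewrite Hk, plus_INR.
  rewrite <- RtoC_minus. f_equal. ring.
Qed.

Lemma nonpos_int_plus_1 z : ~ nonpos_int z -> ~ nonpos_int (z + 1).
Proof. exact (nonpos_int_plus z 1). Qed.

Lemma nonpos_int_neq_0 z : ~ nonpos_int z -> z <> 0.
Proof. intros H E. apply (nonpos_int_shift z 0 H). rewrite E. simpl; ring. Qed.

Lemma poch_neq_0 z n : ~ nonpos_int z -> poch z n <> 0.
Proof.
  intros H. induction n; simpl; [apply C1_nz|].
  apply Cmult_neq_0; trivial. now apply nonpos_int_shift.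
Qed.

Lemma poch_S z n : poch z (S n) = poch z n * (z + RtoC (INR n)).
Proof. reflexivity. Qed.

Lemma poch_S_l z n : poch z (S n) = z * poch (z + 1) n.
Proof.
  induction n as [|n IH]; [simpl; ring|].
  rewrite poch_S, IH, poch_S, RtoC_INR_S. ring.
Qed.

Definition rgs (z : C) (n : nat) : C :=
  poch z (S n) / (RtoC (INR (fact n)) * cpow (INR n) z).

(* The entire function 1/Gamma, as the reciprocal Gauss limit; it vanishes at the poles
   of [Gamma]. *)
Definition rG (z : C) : C := clim_seq (rgs z).

Lemma rgs_neq_0 z n : ~ nonpos_int z -> rgs z n <> 0.
Proof.
  intros Hz. apply Cdiv_neq_0; [now apply poch_neq_0|].
  apply Cmult_neq_0; [apply RtoC_fact_neq_0 | apply cpow_neq_0].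
Qed.

(** The indices start at 1 because [cpow (INR 0) z] rests on the default value of [ln 0]. *)
Lemma rgs_step z n :
  rgs z (S (S n)) - rgs z (S n) =
  ((1 + z / (RtoC (INR n) + 2)) * cexp (z * RtoC (ln (INR n + 1) - ln (INR n + 2))) - 1)
  * rgs z (S n).
Proof.
  unfold rgs. rewrite (poch_S z (S (S n))), (RtoC_fact_S (S n)).
  assert (E : cpow (INR (S (S n))) z
    = cpow (INR (S n)) z / cexp (z * RtoC (ln (INR n + 1) - ln (INR n + 2)))).
  { unfold cpow, Cdiv. rewrite <- cexp_opp, <- cexp_plus. f_equal.
    replace (INR (S (S n))) with (INR n + 2)%R by (rewrite !S_INR; ring).
    rewrite S_INR, RtoC_minus. ring. }
  rewrite E, !RtoC_INR_S.
  pose proof (RtoC_fact_neq_0 (S n)). pose proof (cpow_neq_0 (INR (S n)) z).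
  pose proof (cexp_neq_0 (z * RtoC (ln (INR n + 1) - ln (INR n + 2)))).
  assert (RtoC (INR n) + 2 <> 0).
  { rewrite <- RtoC_plus. apply RtoC_neq_0. pose proof (pos_INR n); lra. }
  replace (RtoC (INR n) + 1 + 1) with (RtoC (INR n) + 2) by ring.
  field. repeat split; trivial.
Qed.

(** Both bounds are ln y <= y - 1, applied to the quotient and to its inverse. *)
Lemma ln_ratio_bounds (x : R) : (0 <= x)%R ->
  (- / (x + 1) <= ln (x + 1) - ln (x + 2) <= - / (x + 2))%R.
Proof.
  intros Hx.
  assert (A : forall y, (0 < y)%R -> (ln y <= y - 1)%R).
  { intros y Hy. pose proof (exp_ineq1_le (ln y)) as H. rewrite exp_ln in H by trivial. lra. }
  rewrite <- ln_div by lra. split.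
  - pose proof (A ((x + 2) / (x + 1))%R) as H.
    rewrite ln_div in * by lra.
    assert (0 < (x + 2) / (x + 1))%R by (apply Rdiv_lt_0_compat; lra).
    replace ((x + 2) / (x + 1) - 1)%R with (/ (x + 1))%R in H by (field; lra). lra.
  - replace (- / (x + 2))%R with ((x + 1) / (x + 2) - 1)%R by (field; lra).
    apply A, Rdiv_lt_0_compat; lra.
Qed.

(* Successive terms of Gauss' product differ by a factor 1 + O(1/n^2). *)
Lemma rgs_slow z : exists K, (0 <= K)%R /\ forall n,
  (Cmod (rgs z (S (S n)) - rgs z (S n))
   <= K * (/ (INR n + 1) - / (INR n + 2)) * Cmod (rgs z (S n)))%R.
Proof.
  set (a := Cmod z). pose proof (Cmod_ge_0 z : (0 <= a)%R) as Ha.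
  exists ((1 + a) * (5 * exp (2 * a) * (4 * a ^ 2)) + (2 * a + 2 * a ^ 2))%R.
  pose proof (exp_pos (2 * a)) as Pe. pose proof (pow2_ge_0 a) as Ha2.
  assert (PK : (0 <= (1 + a) * (5 * exp (2 * a) * (4 * a ^ 2)))%R)
    by (apply Rmult_le_pos; [lra|]; apply Rmult_le_pos; lra).
  split; [lra|]. intros n.
  rewrite rgs_step, Cmod_mult.
  apply Rmult_le_compat_r; [apply Cmod_ge_0|].
  pose proof (pos_INR n) as Pn.
  pose proof (ln_ratio_bounds (INR n) Pn) as Hd.
  set (d := (ln (INR n + 1) - ln (INR n + 2))%R) in *.
  set (m := (INR n + 2)%R) in *.
  assert (Pm : (2 <= m)%R) by (unfold m; lra).
  replace (INR n + 1)%R with (m - 1)%R in * by (unfold m; ring).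
  replace (RtoC (INR n) + 2) with (RtoC m) by (unfold m; now rewrite RtoC_plus).
  set (q := (/ m)%R).
  assert (Pq : (0 < q)%R) by (apply Rinv_0_lt_compat; lra).
  assert (Q1 : (q <= 1)%R) by (unfold q; rewrite <- Rinv_1; apply Rinv_le_contravar; lra).
  assert (Hinv : (/ (m - 1) = q + q * / (m - 1))%R) by (unfold q; field; lra).
  assert (Hi2 : (/ (m - 1) <= 2 * q)%R).
  { unfold q. apply Rmult_le_reg_r with (m * (m - 1))%R; [nra|].
    replace (/ (m - 1) * (m * (m - 1)))%R with m by (field; lra).
    replace (2 * / m * (m * (m - 1)))%R with (2 * (m - 1))%R by (field; lra). lra. }
  assert (Hi1 : (q <= / (m - 1))%R) by (unfold q; apply Rinv_le_contravar; lra).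
  assert (Hm : (/ (m - 1) - q <= 2 * q ^ 2)%R) by nra.
  assert (Hq : (q ^ 2 <= / (m - 1) - q)%R) by nra.
  fold q in Hd.
  assert (Hd1 : (Rabs d <= 2 * q)%R) by (apply Rabs_le; lra).
  assert (Hd2 : (Rabs (d + q) <= 2 * q ^ 2)%R) by (apply Rabs_le; lra).
  apply Rle_trans with
    (((1 + a) * (5 * exp (2 * a) * (4 * a ^ 2)) + (2 * a + 2 * a ^ 2)) * q ^ 2)%R;
    [|apply Rmult_le_compat_l; lra].
  assert (Hqm : RtoC q * RtoC m = 1)
    by (rewrite <- RtoC_mult; unfold q; rewrite Rinv_l; trivial; lra).
  assert (Hm0 : RtoC m <> 0) by (apply RtoC_neq_0; lra).
  replace (z / RtoC m) with (z * RtoC q)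
    by (replace (z * RtoC q) with (z * (RtoC q * RtoC m) / RtoC m) by (field; trivial);
        rewrite Hqm; field; trivial).
  set (w := z * RtoC d).
  assert (Hw : (Cmod w <= 2 * a * q)%R).
  { unfold w. rewrite Cmod_mult, Cmod_R. fold a. nra. }
  (* The first-order terms z q and w = z d cancel up to z (d + q), since d = -q + O(q^2). Each of
     the three summands left is O(q^2), and their constants add up to the witness given at the
     start. *)
  replace ((1 + z * RtoC q) * cexp w - 1) with
    ((1 + z * RtoC q) * (cexp w - 1 - w) + (z * RtoC (d + q) + z * RtoC q * w))
    by (unfold w; rewrite RtoC_plus; ring).
  assert (B1 : (Cmod (1 + z * RtoC q) <= 1 + a)%R).
  { eapply Rle_trans; [apply Cmod_triangle|].
    rewrite Cmod_1, Cmod_mult, Cmod_R, (Rabs_pos_eq q) by lra. fold a. nra. }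
  assert (B2 : (Cmod (cexp w - 1 - w) <= 5 * exp (2 * a) * (4 * a ^ 2) * q ^ 2)%R).
  { eapply Rle_trans; [apply cexp_taylor1|].
    rewrite (Rmult_assoc _ (4 * a ^ 2)). pose proof (Cmod_ge_0 w).
    apply Rmult_le_compat; [left; pose proof (exp_pos (Cmod w)); lra | apply pow2_ge_0 | |].
    - apply Rmult_le_compat_l; [lra|]. apply exp_le_mono. nra.
    - replace (4 * a ^ 2 * q ^ 2)%R with ((2 * a * q) ^ 2)%R by ring.
      now apply pow_incr. }
  eapply Rle_trans; [apply Cmod_triangle|]. rewrite Rmult_plus_distr_r.
  apply Rplus_le_compat.
  - rewrite Cmod_mult, Rmult_assoc. apply Rmult_le_compat; trivial; apply Cmod_ge_0.
  - eapply Rle_trans; [apply Cmod_triangle|].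
    rewrite !Cmod_mult, !Cmod_R, (Rabs_pos_eq q) by lra. fold a.
    pose proof (Rabs_pos (d + q)).
    assert (a * Rabs (d + q) <= a * (2 * q ^ 2))%R by (apply Rmult_le_compat_l; trivial).
    assert (a * q * Cmod w <= a * q * (2 * a * q))%R
      by (apply Rmult_le_compat_l; trivial; nra).
    lra.
Qed.

Lemma rG_lim_neq z : Clim (rgs z) (rG z) /\ (~ nonpos_int z -> rG z <> 0).
Proof.
  destruct (rgs_slow z) as [K [PK HK]].
  pose proof (slow_converges (fun n => rgs z (S n)) K PK HK) as H.
  pose proof (slow_limit_neq_0 (fun n => rgs z (S n)) K PK HK) as H0.
  pose proof (proj1 (Clim_incr_1 (rgs z) _) H) as H1.
  unfold rG. rewrite (clim_seq_unique _ _ H1). split; trivial.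
  intros Hz. apply H0. intros n. now apply rgs_neq_0.
Qed.

Lemma rG_lim z : Clim (rgs z) (rG z).
Proof. apply rG_lim_neq. Qed.

Lemma rG_neq_0 z : ~ nonpos_int z -> rG z <> 0.
Proof. apply rG_lim_neq. Qed.

Lemma Gamma_rG z : ~ nonpos_int z -> Gamma z = / rG z.
Proof.
  intros Hz. apply clim_seq_unique.
  apply Clim_ext with (fun n => / rgs z n).
  - intros n. unfold Gamma_seq, rgs.
    pose proof (RtoC_fact_neq_0 n). pose proof (cpow_neq_0 (INR n) z).
    pose proof (poch_neq_0 z (S n) Hz). field. auto.
  - apply Clim_inv; [now apply rG_neq_0 | apply rG_lim].
Qed.

Lemma Gamma_neq_0 z : ~ nonpos_int z -> Gamma z <> 0.
Proof. intros Hz. rewrite Gamma_rG by trivial. now apply Cinv_neq_0, rG_neq_0. Qed.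

Lemma rG_Gamma z : ~ nonpos_int z -> rG z = / Gamma z.
Proof.
  intros Hz. rewrite Gamma_rG by trivial. pose proof (rG_neq_0 z Hz). field; trivial.
Qed.

Lemma Clim_RtoC (x : nat -> R) (l : R) : is_lim_seq x l -> Clim (fun n => RtoC (x n)) (RtoC l).
Proof. intros H. apply Clim_components. simpl. split; trivial. apply is_lim_seq_const. Qed.

Lemma Clim_inv_INR (k : nat) : Clim (fun n => / (RtoC (INR n) + RtoC (INR (S k)))) 0.
Proof.
  apply Clim_ext with (fun n => RtoC (/ (INR n + INR (S k)))).
  - intros n. rewrite RtoC_inv, RtoC_plus; trivial.
    rewrite S_INR. pose proof (pos_INR n). pose proof (pos_INR k). lra.
  - apply Clim_RtoC, is_lim_seq_inv_INR.
Qed.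

(** The Gauss quotients of the two sides at index n + 1 differ by the factor 1 + (z + 1)/(n + 1),
    which tends to 1. The poles of [Gamma] are included, as the contiguous relations require. *)
Lemma rG_rec z : rG z = z * rG (z + 1).
Proof.
  apply Clim_unique with (fun n => z * rgs (z + 1) (S n)).
  - apply Clim_ext with
      (fun n => rgs z (S n) * (1 + (z + 1) * / (RtoC (INR n) + RtoC (INR 1)))).
    + intros n. unfold rgs. change (INR 1) with 1%R.
      assert (E : z * poch (z + 1) (S (S n)) = poch z (S (S n)) * (z + RtoC (INR n) + 2)).
      { rewrite <- poch_S_l, (poch_S z (S (S n))), !RtoC_INR_S. ring. }
      unfold Cdiv at 2. rewrite Cmult_assoc.
      rewrite E, cpow_plus, cpow_1, RtoC_INR_S by (apply lt_0_INR; lia).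
      pose proof (RtoC_fact_neq_0 (S n)). pose proof (cpow_neq_0 (INR (S n)) z).
      pose proof (RtoC_INR_S_neq_0 n). field. auto.
    + replace (rG z) with (rG z * (1 + (z + 1) * 0)) by ring.
      apply Clim_mult; [apply Clim_incr_1, rG_lim|].
      apply Clim_plus; [apply Clim_const|]. apply Clim_scal, Clim_inv_INR.
  - apply Clim_scal, Clim_incr_1, rG_lim.
Qed.

Lemma Gamma_rec z : ~ nonpos_int z -> Gamma (z + 1) = z * Gamma z.
Proof.
  intros Hz. pose proof (nonpos_int_plus_1 z Hz).
  rewrite !Gamma_rG, (rG_rec z) by trivial.
  pose proof (rG_neq_0 (z + 1)). pose proof (nonpos_int_neq_0 z Hz). field; auto.
Qed.

Lemma rG_poch z n : rG z = poch z n * rG (z + RtoC (INR n)).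
Proof.
  induction n as [|n IH].
  - simpl. replace (z + 0) with z by ring. ring.
  - rewrite IH, (rG_rec (z + RtoC (INR n))), poch_S, RtoC_INR_S.
    rewrite <- (Cplus_assoc z). ring.
Qed.

Lemma Gamma_poch z n : ~ nonpos_int z -> Gamma (z + RtoC (INR n)) = poch z n * Gamma z.
Proof.
  intros Hz. rewrite !Gamma_rG, (rG_poch z n); trivial; [|now apply nonpos_int_plus].
  pose proof (rG_neq_0 _ (nonpos_int_plus z n Hz)). pose proof (poch_neq_0 z n Hz).
  field; auto.
Qed.

(** * The regularised hypergeometric series at 1/2 *)

(** The quotient (x + n)/(y + n) tends to 1; the product form avoids a division by y + n, which may
    vanish for some n. *)
Lemma Cmod_shift_ratio (x y : C) (r : R) : (1 < r)%R ->
  exists N, forall n, (N <= n)%nat ->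
    (Cmod (x + RtoC (INR n)) <= r * Cmod (y + RtoC (INR n)))%R.
Proof.
  intros Hr.
  (* [B] solves |x| + n = r (n - |y|) for n. *)
  set (B := ((Cmod x + r * Cmod y) / (r - 1))%R).
  assert (HB : (0 <= B)%R).
  { apply Rmult_le_pos; [|left; apply Rinv_0_lt_compat; lra].
    pose proof (Cmod_ge_0 x). pose proof (Cmod_ge_0 y). nra. }
  destruct (nfloor_ex B HB) as [N [_ HN]].
  exists (S N). intros n Hn. apply le_INR in Hn. rewrite S_INR in Hn.
  pose proof (pos_INR n) as Pn.
  assert (H1 : (Cmod (x + RtoC (INR n)) <= Cmod x + INR n)%R).
  { eapply Rle_trans; [apply Cmod_triangle|]. rewrite Cmod_R, Rabs_pos_eq; lra. }
  assert (H2 : (INR n - Cmod y <= Cmod (y + RtoC (INR n)))%R).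
  { pose proof (Cmod_triangle (y + RtoC (INR n)) (- y)) as H.
    replace (y + RtoC (INR n) + - y) with (RtoC (INR n)) in H by ring.
    rewrite Cmod_opp, Cmod_R, Rabs_pos_eq in H; lra. }
  assert (H3 : (B * (r - 1) = Cmod x + r * Cmod y)%R) by (unfold B; field; lra).
  nra.
Qed.

(** The terms before [N] are peeled off one at a time and absorbed into [M], so that the bound holds
    from index 0. *)
Lemma eventually_ratio_geom (r : R) (N : nat) : (0 < r)%R -> forall u : nat -> C,
  (forall n, (N <= n)%nat -> (Cmod (u (S n)) <= r * Cmod (u n))%R) ->
  exists M, (0 <= M)%R /\ forall n, (Cmod (u n) <= M * r ^ n)%R.
Proof.
  intros Hr. induction N as [|N IH]; intros u Hu.
  - exists (Cmod (u 0%nat)). split; [apply Cmod_ge_0|].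
    induction n as [|n IHn]; [simpl; lra|].
    eapply Rle_trans; [apply Hu; lia|]. simpl.
    apply Rmult_le_compat_l with (r := r) in IHn; lra.
  - destruct (IH (fun n => u (S n))) as [M [PM HM]]; [intros; apply Hu; lia|].
    exists (Cmod (u 0%nat) + M / r)%R.
    assert (0 <= M / r)%R by (apply Rmult_le_pos; trivial; left; now apply Rinv_0_lt_compat).
    pose proof (Cmod_ge_0 (u 0%nat)). split; [lra|].
    intros [|n]; [simpl; lra|].
    eapply Rle_trans; [apply HM|]. simpl.
    replace ((Cmod (u 0%nat) + M / r) * (r * r ^ n))%R
      with (Cmod (u 0%nat) * (r * r ^ n) + M * r ^ n)%R by (field; lra).
    assert (0 <= Cmod (u 0%nat) * (r * r ^ n))%R; [|lra].
    apply Rmult_le_pos; trivial. apply Rmult_le_pos; [lra|]. apply pow_le; lra.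
Qed.

Lemma poch_1 n : poch 1 n = RtoC (INR (fact n)).
Proof.
  induction n as [|n IH]; [reflexivity|].
  rewrite poch_S, IH, RtoC_fact_S. ring.
Qed.

Lemma one_not_nonpos_int : ~ nonpos_int 1.
Proof. intros [k Hk]. apply (f_equal Re) in Hk. simpl in Hk. pose proof (pos_INR k). lra. Qed.

(** The quotient grows only polynomially, so any ratio above 1 would do. With 11/10, three such
    factors times 1/2 stay below 3/4, and two of them times 3/4 stay below 1; later estimates use
    both. *)
Lemma poch_ratio_geom x y : ~ nonpos_int y ->
  exists M, (0 <= M)%R /\ forall n, (Cmod (poch x n / poch y n) <= M * (11 / 10) ^ n)%R.
Proof.
  intros Hy. destruct (Cmod_shift_ratio x y (11 / 10)) as [N HN]; [lra|].
  apply eventually_ratio_geom with N; [lra|]. intros n Hn. specialize (HN n Hn).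
  pose proof (poch_neq_0 y n Hy). pose proof (nonpos_int_shift y n Hy) as Hyn.
  rewrite !poch_S.
  replace (poch x n * (x + RtoC (INR n)) / (poch y n * (y + RtoC (INR n))))
    with ((x + RtoC (INR n)) / (y + RtoC (INR n)) * (poch x n / poch y n)) by (field; auto).
  rewrite Cmod_mult. apply Rmult_le_compat_r; [apply Cmod_ge_0|].
  rewrite Cmod_div by trivial.
  apply (proj1 (Cmod_gt_0 _)) in Hyn.
  apply Rmult_le_reg_r with (Cmod (y + RtoC (INR n))); trivial.
  unfold Rdiv at 1. rewrite Rmult_assoc, Rinv_l by lra. lra.
Qed.

Lemma poch_fact_geom x :
  exists M, (0 <= M)%R /\
    forall n, (Cmod (poch x n / RtoC (INR (fact n))) <= M * (11 / 10) ^ n)%R.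
Proof.
  destruct (poch_ratio_geom x 1 one_not_nonpos_int) as [M [PM HM]].
  exists M; split; trivial. intros n. now rewrite <- poch_1.
Qed.

Lemma ex_series_geom_34 (M : R) : ex_series (fun n => M * (3 / 4) ^ n)%R.
Proof.
  apply (ex_series_scal (V := R_NormedModule) M (fun n => (3 / 4) ^ n)%R).
  apply ex_series_geom. rewrite Rabs_pos_eq; lra.
Qed.

Lemma is_lim_seq_geom_0 (M q : R) : (0 <= q < 1)%R -> is_lim_seq (fun n => M * q ^ n)%R 0%R.
Proof.
  intros Hq. replace (Finite 0) with (Finite (M * 0)) by (f_equal; ring).
  apply is_lim_seq_mult'; [apply is_lim_seq_const|].
  apply is_lim_seq_geom. rewrite Rabs_pos_eq; lra.
Qed.

(** For regular [G] the factor [rG (G + n)] is 1 / (Gamma(G) (G)_n); in this form it also makes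
    sense when (G)_n vanishes. *)
Definition hyp (A B G : C) (n : nat) : C :=
  poch A n * poch B n * rG (G + RtoC (INR n)) / RtoC (INR (fact n)) * RtoC (/ 2) ^ n.

(* The regularised Gauss function 2F1(A, B; G; 1/2) / Gamma(G), defined for every [G]. *)
Definition Hyp (A B G : C) : C := clim_seq (sum_n (hyp A B G)).

Lemma hyp_S A B G n :
  (G + RtoC (INR n)) * (1 + RtoC (INR n)) * hyp A B G (S n) =
  RtoC (/ 2) * (A + RtoC (INR n)) * (B + RtoC (INR n)) * hyp A B G n.
Proof.
  unfold hyp. rewrite !poch_S, RtoC_fact_S, (rG_rec (G + RtoC (INR n))), RtoC_INR_S.
  rewrite <- (Cplus_assoc G). simpl Cpow.
  pose proof (RtoC_fact_neq_0 n). pose proof (RtoC_INR_S_neq_0 n). field. auto.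
Qed.

Lemma hyp_geom A B G : exists M, forall n, (Cmod (hyp A B G n) <= M * (3 / 4) ^ n)%R.
Proof.
  (* The ratio 6/5 is chosen because (6/5)^2 / 2 = 18/25 < 3/4. The third bound, n <= 2 |G + n|,
     keeps G + n away from 0. *)
  destruct (Cmod_shift_ratio A G (6 / 5)) as [N1 H1]; [lra|].
  destruct (Cmod_shift_ratio B 1 (6 / 5)) as [N2 H2]; [lra|].
  destruct (Cmod_shift_ratio 0 G 2) as [N3 H3]; [lra|].
  destruct (eventually_ratio_geom (3 / 4) (S (N1 + N2 + N3)) ltac:(lra) (hyp A B G))
    as [M [_ HM]]; [|now exists M].
  intros n Hn. specialize (H1 n ltac:(lia)). specialize (H2 n ltac:(lia)).
  specialize (H3 n ltac:(lia)).
  assert (Pn : (1 <= INR n)%R) by (apply (le_INR 1); lia).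
  rewrite Cplus_0_l, Cmod_R, Rabs_pos_eq in H3 by lra.
  assert (P1 : (1 <= Cmod (1 + RtoC (INR n)))%R).
  { rewrite <- RtoC_plus, Cmod_R, Rabs_pos_eq; lra. }
  pose proof (f_equal Cmod (hyp_S A B G n)) as E. rewrite !Cmod_mult, Cmod_R in E.
  rewrite (Rabs_pos_eq (/ 2)) in E by lra.
  set (g := Cmod (G + RtoC (INR n))) in *. set (o := Cmod (1 + RtoC (INR n))) in *.
  set (x := Cmod (A + RtoC (INR n))) in *. set (y := Cmod (B + RtoC (INR n))) in *.
  assert (Pg : (0 < g)%R) by lra.
  apply Rmult_le_reg_l with (g * o)%R; [nra|]. rewrite E.
  pose proof (Cmod_ge_0 (hyp A B G n)) as Ph.
  assert (Px : (0 <= x)%R) by apply Cmod_ge_0. assert (Py : (0 <= y)%R) by apply Cmod_ge_0.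
  assert (Hxy : (x * y <= (6 / 5 * g) * (6 / 5 * o))%R) by (apply Rmult_le_compat; trivial).
  rewrite <- !Rmult_assoc. apply Rmult_le_compat_r; trivial. nra.
Qed.

Lemma Hyp_series A B G : Cser (hyp A B G) (Hyp A B G).
Proof.
  destruct (hyp_geom A B G) as [M HM].
  apply Cser_dominated with (fun n => M * (3 / 4) ^ n)%R; trivial. apply ex_series_geom_34.
Qed.

Lemma hyp_lim_0 A B G : Clim (hyp A B G) 0.
Proof.
  destruct (hyp_geom A B G) as [M HM].
  apply Clim_squeeze with (fun n => M * (3 / 4) ^ n)%R 0%nat.
  - intros n _. replace (hyp A B G n - 0) with (hyp A B G n) by ring. apply HM.
  - apply is_lim_seq_geom_0; lra.
Qed.

(** * Antidiagonal summation and the Pfaff-Saalschütz identity *)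

Lemma Csum_sub_bound (a : nat -> C) (e : R) (J N : nat) : (J <= N)%nat ->
  (forall j, (J < j <= N)%nat -> (Cmod (a j) <= e)%R) ->
  (Cmod (sum_n a N - sum_n a J) <= INR (N - J) * e)%R.
Proof.
  intros HJ. induction HJ as [|N HJ IH]; intros H.
  - rewrite Nat.sub_diag. replace (sum_n a J - sum_n a J) with (RtoC 0) by (toC; ring).
    rewrite Cmod_0. simpl; lra.
  - rewrite Csum_S.
    replace (sum_n a N + a (S N) - sum_n a J) with ((sum_n a N - sum_n a J) + a (S N))
      by (toC; ring).
    eapply Rle_trans; [apply Cmod_triangle|].
    replace (S N - J)%nat with (S (N - J)) by lia. rewrite S_INR.
    specialize (IH ltac:(intros; apply H; lia)). specialize (H (S N) ltac:(lia)). lra.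
Qed.

Lemma triangle_rows (t : nat -> nat -> C) N :
  sum_n (fun n => sum_n (fun i => t i (n - i)%nat) n) N =
  sum_n (fun i => sum_n (t i) (N - i)) N.
Proof.
  induction N as [|N IH]; [now rewrite !Csum_0|].
  rewrite Csum_S, IH, (Csum_S (fun i => sum_n (t i) (S N - i))), Csum_S.
  rewrite !Nat.sub_diag, Csum_0.
  rewrite (Csum_ext (fun i => sum_n (t i) (S N - i))
             (fun i => sum_n (t i) (N - i) + t i (S N - i)%nat)), Csum_plus.
  - toC; ring.
  - intros k Hk. replace (S N - k)%nat with (S (N - k)) by lia. apply Csum_S.
Qed.

Lemma S_le_pow n : (INR n + 1 <= 10 * (11 / 10) ^ n)%R.
Proof.
  induction n as [|n IH]; [simpl; lra|]. rewrite S_INR. simpl.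
  pose proof (pow_R1_Rle (11 / 10) n). lra.
Qed.

(** Square and triangle differ by entries with i + j > n, each at most M (3/4)^n. There are fewer
    than (n + 1)^2 of them, and n + 1 <= 10 (11/10)^n leaves 100 M (363/400)^n, where 363/400 =
    (11/10)^2 (3/4). *)
Lemma square_to_triangle (t : nat -> nat -> C) (M : R) (L : C) :
  (forall i j, (Cmod (t i j) <= M * (3 / 4) ^ (i + j))%R) ->
  Clim (fun n => sum_n (fun i => sum_n (t i) n) n) L ->
  Cser (fun n => sum_n (fun i => t i (n - i)%nat) n) L.
Proof.
  intros Ht HL.
  assert (PM : (0 <= M)%R).
  { specialize (Ht 0%nat 0%nat). pose proof (Cmod_ge_0 (t 0%nat 0%nat)). simpl in Ht. lra. }
  replace L with (L - 0) by ring.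
  apply Clim_ext with (fun n => sum_n (fun i => sum_n (t i) n) n
    - (sum_n (fun i => sum_n (t i) n) n
       - sum_n (fun n => sum_n (fun i => t i (n - i)%nat) n) n)); [intros; toC; ring|].
  apply Clim_minus; trivial.
  apply Clim_squeeze with (fun n => (100 * M) * (363 / 400) ^ n)%R 0%nat;
    [|apply is_lim_seq_geom_0; lra].
  intros n _. rewrite triangle_rows.
  replace (sum_n (fun i => sum_n (t i) n) n - sum_n (fun i => sum_n (t i) (n - i)) n - 0)
    with (sum_n (fun i => sum_n (t i) n + (-(1)) * sum_n (t i) (n - i)) n)
    by (rewrite Csum_plus, Csum_scal; toC; ring).
  pose proof (pos_INR n) as Pn.
  assert (Pq : (0 <= (3 / 4) ^ n)%R) by (apply pow_le; lra).
  apply Rle_trans with (sum_n (fun _ => (INR n + 1) * (M * (3 / 4) ^ n))%R n).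
  - apply Csum_Cmod. intros i Hi.
    replace (sum_n (t i) n + (-(1)) * sum_n (t i) (n - i))
      with (sum_n (t i) n - sum_n (t i) (n - i)) by (toC; ring).
    eapply Rle_trans; [apply Csum_sub_bound with (e := (M * (3 / 4) ^ n)%R); [lia|]|].
    + intros j Hj. eapply Rle_trans; [apply Ht|]. apply Rmult_le_compat_l; trivial.
      replace (i + j)%nat with (n + (i + j - n))%nat by lia. rewrite pow_add.
      rewrite <- (Rmult_1_r ((3 / 4) ^ n)) at 2. apply Rmult_le_compat_l; trivial.
      rewrite <- (pow1 (i + j - n)). apply pow_incr; lra.
    + apply Rmult_le_compat_r; [now apply Rmult_le_pos|].
      assert (INR (n - (n - i)) <= INR n)%R by (apply le_INR; lia). lra.
  - rewrite sum_n_const, S_INR.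
    replace ((363 / 400) ^ n)%R with ((11 / 10) ^ n * (11 / 10) ^ n * (3 / 4) ^ n)%R
      by (rewrite <- !Rpow_mult_distr; f_equal; field).
    pose proof (S_le_pow n) as H.
    assert (H2 : ((INR n + 1) * (INR n + 1) <= (10 * (11 / 10) ^ n) * (10 * (11 / 10) ^ n))%R)
      by (apply Rmult_le_compat; lra).
    apply Rmult_le_compat_r with (r := (M * (3 / 4) ^ n)%R) in H2; [|now apply Rmult_le_pos].
    lra.
Qed.

Section Saalschutz.
Variables a b c : C.
Hypothesis Hc : ~ nonpos_int c.

(** [saal_p] gives the Taylor coefficients of 2F1(a, b; c; x), and [saal_q s] those of (1 - x)^(-s).
    The Pfaff-Saalschütz identity thereby becomes a statement about a Cauchy product. *)
Definition saal_p (k : nat) : C :=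
  poch a k * poch b k / (poch c k * RtoC (INR (fact k))).
Definition saal_q (s : C) (j : nat) : C := poch s j / RtoC (INR (fact j)).

Lemma saal_p_S k :
  (a + RtoC (INR k)) * (b + RtoC (INR k)) * saal_p k =
  (RtoC (INR k) + 1) * (c + RtoC (INR k)) * saal_p (S k).
Proof.
  unfold saal_p. rewrite !poch_S, RtoC_fact_S.
  pose proof (RtoC_fact_neq_0 k). pose proof (RtoC_INR_S_neq_0 k).
  pose proof (poch_neq_0 c k Hc). pose proof (nonpos_int_shift c k Hc). field. auto.
Qed.

Lemma saal_q_S s j :
  saal_q s (S j) = (s + RtoC (INR j)) * saal_q s j / (RtoC (INR j) + 1).
Proof.
  unfold saal_q. rewrite !poch_S, RtoC_fact_S.
  pose proof (RtoC_fact_neq_0 j). pose proof (RtoC_INR_S_neq_0 j). field. auto.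
Qed.

Let s := c - a - b.

(* Zeilberger's recurrence: the right-hand side is the certificate. *)
Lemma saal_partial n K : (K <= n)%nat ->
  sum_n (fun k => (RtoC (INR n) + 1) * (c + RtoC (INR n)) * (saal_p k * saal_q s (S n - k))
    + - ((c - a + RtoC (INR n)) * (c - b + RtoC (INR n))) * (saal_p k * saal_q s (n - k))) K
  = - ((a + RtoC (INR K)) * (b + RtoC (INR K)) * (saal_p K * saal_q s (n - K))).
Proof.
  induction K as [|K IH]; intros HK.
  - rewrite Csum_0, !Nat.sub_0_r, saal_q_S. pose proof (RtoC_INR_S_neq_0 n).
    change (INR 0) with 0%R. toC. unfold s. field. trivial.
  - rewrite Csum_S, IH by lia.
    destruct (Nat.le_exists_sub (S K) n HK) as [j [-> _]].
    replace (S (j + S K) - S K)%nat with (S j) by lia.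
    replace (j + S K - K)%nat with (S j) by lia.
    replace (j + S K - S K)%nat with j by lia.
    replace ((a + RtoC (INR K)) * (b + RtoC (INR K)) * (saal_p K * saal_q s (S j)))
      with ((RtoC (INR K) + 1) * (c + RtoC (INR K)) * saal_p (S K) * saal_q s (S j))
      by (rewrite <- saal_p_S; ring).
    rewrite saal_q_S, plus_INR, RtoC_plus, RtoC_INR_S. pose proof (RtoC_INR_S_neq_0 j).
    toC. unfold s. field. trivial.
Qed.

(** At [K = n] the certificate is, up to the factor (n + 1)(c + n), the term k = n + 1 that the
    recurrence leaves out. Both sides therefore satisfy the same first-order recurrence in n. *)
Lemma pfaff_saalschutz n :
  sum_n (fun k => saal_p k * saal_q s (n - k)) n =
  poch (c - a) n * poch (c - b) n / (poch c n * RtoC (INR (fact n))).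
Proof.
  induction n as [|n IH].
  - rewrite Csum_0. unfold saal_p, saal_q. simpl. toC. field.
  - pose proof (saal_partial n n (Nat.le_refl n)) as H.
    rewrite Csum_plus, !Csum_scal, IH, Nat.sub_diag in H.
    rewrite Csum_S, Nat.sub_diag.
    pose proof (RtoC_fact_neq_0 n). pose proof (RtoC_INR_S_neq_0 n) as Hn.
    pose proof (poch_neq_0 c n Hc). pose proof (nonpos_int_shift c n Hc) as Hcn.
    replace ((a + RtoC (INR n)) * (b + RtoC (INR n)) * (saal_p n * saal_q s 0))
      with ((RtoC (INR n) + 1) * (c + RtoC (INR n)) * saal_p (S n) * saal_q s 0) in H
      by (rewrite <- saal_p_S; ring).
    set (X := sum_n (fun k => saal_p k * saal_q s (S n - k)) n) in *.
    assert (E : (RtoC (INR n) + 1) * (c + RtoC (INR n)) * (X + saal_p (S n) * saal_q s 0)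
      = (c - a + RtoC (INR n)) * (c - b + RtoC (INR n)) *
        (poch (c - a) n * poch (c - b) n / (poch c n * RtoC (INR (fact n))))).
    { set (Y := poch (c - a) n * poch (c - b) n / (poch c n * RtoC (INR (fact n)))) in *.
      assert (E0 : forall x y z w : C, x + - y * z = - w -> x + w = y * z).
      { intros x y z w E0. replace x with ((x + - y * z) + y * z) by ring. rewrite E0. ring. }
      rewrite <- (E0 _ _ _ _ H). toC. ring. }
    replace (X + saal_p (S n) * saal_q s 0) with
      ((RtoC (INR n) + 1) * (c + RtoC (INR n)) * (X + saal_p (S n) * saal_q s 0)
       / ((RtoC (INR n) + 1) * (c + RtoC (INR n)))) by (toC; field; auto).
    rewrite E, !poch_S, RtoC_fact_S. toC. field. auto.
Qed.
End Saalschutz.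

(** * The binomial series and Euler's transformation *)

(** This is the real part of (1 - t) f' = s f, the equation of f = (1 - t)^(-s) with s = x + iy. The
    imaginary part is the same statement with [p] and [q] exchanged and [y] negated. *)
Lemma PSeries_binomial_ode (x y t : R) (p q : nat -> R) :
  (forall n, INR (S n) * p (S n) = x * p n - y * q n + INR n * p n)%R ->
  Rbar_lt (Rabs t) (CV_radius p) -> Rbar_lt (Rabs t) (CV_radius q) ->
  ((1 - t) * PSeries (PS_derive p) t = x * PSeries p t - y * PSeries q t)%R.
Proof.
  intros H Hp Hq.
  assert (E : PSeries (PS_derive p) t =
    (x * PSeries p t - y * PSeries q t + t * PSeries (PS_derive p) t)%R); [|lra].
  apply CV_radius_inside in Hq.
  assert (Hd : ex_pseries (PS_derive p) t)
    by (apply CV_radius_inside; now rewrite CV_radius_derive).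
  apply CV_radius_inside in Hp.
  rewrite <- PSeries_incr_1, <- !PSeries_scal, <- PSeries_minus, <- PSeries_plus.
  - apply PSeries_ext. intros n. unfold PS_plus, PS_minus, PS_scal, PS_derive.
    rewrite H. change (x * p n - y * q n + INR n * p n =
      (x * p n - y * q n) + PS_incr_1 (fun n => INR (S n) * p (S n))%R n)%R.
    destruct n; [simpl; unfold zero; simpl; ring | reflexivity].
  - apply ex_pseries_minus; apply ex_pseries_scal; trivial; apply Rmult_comm.
  - now apply ex_pseries_incr_1.
  - apply ex_pseries_scal; trivial; apply Rmult_comm.
  - apply ex_pseries_scal; trivial; apply Rmult_comm.
Qed.

(* Both components of (1 - t)^s * sum_n (s)_n t^n / n! have zero derivative on [0, 1/2]. *)
Lemma PSeries_binomial_half (x y : R) (p q : nat -> R) :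
  (forall n, INR (S n) * p (S n) = x * p n - y * q n + INR n * p n)%R ->
  (forall n, INR (S n) * q (S n) = x * q n + y * p n + INR n * q n)%R ->
  p 0%nat = 1%R -> q 0%nat = 0%R ->
  Rbar_lt (/ 2)%R (CV_radius p) -> Rbar_lt (/ 2)%R (CV_radius q) ->
  cexp (- ((x, y) * RtoC (ln 2))) * (PSeries p (/ 2), PSeries q (/ 2)) = 1.
Proof.
  intros Hp Hq Hp0 Hq0 Rp Rq.
  set (P := PSeries p). set (Q := PSeries q).
  assert (Rt : forall t, (0 <= t <= / 2)%R -> forall a, Rbar_lt (/ 2)%R (CV_radius a) ->
    Rbar_lt (Rabs t) (CV_radius a)).
  { intros t Ht a Ha. eapply Rbar_le_lt_trans; [|exact Ha]. simpl.
    rewrite Rabs_pos_eq; lra. }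
  assert (DP : forall t, (0 <= t <= / 2)%R -> is_derive P t ((x * P t - y * Q t) / (1 - t))%R).
  { intros t Ht. pose proof (is_derive_PSeries p t (Rt t Ht p Rp)) as D.
    pose proof (PSeries_binomial_ode x y t p q Hp (Rt t Ht p Rp) (Rt t Ht q Rq)) as E.
    fold P Q in E. rewrite <- E.
    replace ((1 - t) * PSeries (PS_derive p) t / (1 - t))%R with (PSeries (PS_derive p) t)
      by (field; lra). exact D. }
  assert (DQ : forall t, (0 <= t <= / 2)%R -> is_derive Q t ((x * Q t + y * P t) / (1 - t))%R).
  { intros t Ht. pose proof (is_derive_PSeries q t (Rt t Ht q Rq)) as D.
    pose proof (PSeries_binomial_ode x (- y) t q p) as E.
    specialize (E ltac:(intros; rewrite Hq; ring) (Rt t Ht q Rq) (Rt t Ht p Rp)).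
    fold P Q in E. replace (x * Q t + y * P t)%R with (x * Q t - - y * P t)%R by ring.
    rewrite <- E.
    replace ((1 - t) * PSeries (PS_derive q) t / (1 - t))%R with (PSeries (PS_derive q) t)
      by (field; lra). exact D. }
  assert (P0 : P 0%R = 1%R) by (unfold P; now rewrite PSeries_0).
  assert (Q0 : Q 0%R = 0%R) by (unfold Q; now rewrite PSeries_0).
  set (f := fun t => (exp (x * ln (1 - t)) *
    (cos (y * ln (1 - t)) * P t - sin (y * ln (1 - t)) * Q t))%R).
  set (g := fun t => (exp (x * ln (1 - t)) *
    (sin (y * ln (1 - t)) * P t + cos (y * ln (1 - t)) * Q t))%R).
  assert (Ef : f 0%R = f (/ 2)%R).
  { apply (eq_is_derive (V := R_NormedModule)); [|lra]. intros t Ht. unfold f.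
    evar_last.
    - apply (is_derive_mult (fun t => exp (x * ln (1 - t)))
        (fun t => cos (y * ln (1 - t)) * P t - sin (y * ln (1 - t)) * Q t)%R);
      [auto_derive; [lra|reflexivity] | | apply Rmult_comm].
      apply (is_derive_minus (V := R_NormedModule)).
      + apply (is_derive_mult (fun t => cos (y * ln (1 - t)))%R P);
          [auto_derive; [lra|reflexivity] | now apply DP | apply Rmult_comm].
      + apply (is_derive_mult (fun t => sin (y * ln (1 - t)))%R Q);
          [auto_derive; [lra|reflexivity] | now apply DQ | apply Rmult_comm].
    - unfold plus, minus, plus, opp, mult, zero; simpl. unfold mult; simpl.
      change (1 + - t)%R with (1 - t)%R. field. lra. }
  assert (Eg : g 0%R = g (/ 2)%R).
  { apply (eq_is_derive (V := R_NormedModule)); [|lra]. intros t Ht. unfold g.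
    evar_last.
    - apply (is_derive_mult (fun t => exp (x * ln (1 - t)))
        (fun t => sin (y * ln (1 - t)) * P t + cos (y * ln (1 - t)) * Q t)%R);
      [auto_derive; [lra|reflexivity] | | apply Rmult_comm].
      apply (is_derive_plus (V := R_NormedModule)).
      + apply (is_derive_mult (fun t => sin (y * ln (1 - t)))%R P);
          [auto_derive; [lra|reflexivity] | now apply DP | apply Rmult_comm].
      + apply (is_derive_mult (fun t => cos (y * ln (1 - t)))%R Q);
          [auto_derive; [lra|reflexivity] | now apply DQ | apply Rmult_comm].
    - unfold plus, mult, zero; simpl. unfold mult; simpl.
      change (1 + - t)%R with (1 - t)%R. field. lra. }
  unfold f in Ef. unfold g in Eg. rewrite P0, Q0, Rminus_0_r, ln_1, !Rmult_0_r, exp_0, sin_0, cos_0 in *.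
  replace (1 - / 2)%R with (/ 2)%R in * by field. rewrite ln_Rinv in * by lra.
  unfold cexp, Cmult, Copp, RtoC; simpl. f_equal.
  - rewrite !Rmult_0_r, Rminus_0_r, Rplus_0_l, <- !Ropp_mult_distr_r in *.
    fold P Q. lra.
  - rewrite !Rmult_0_r, Rminus_0_r, Rplus_0_l, <- !Ropp_mult_distr_r in *.
    fold P Q. lra.
Qed.

Lemma Re_sum_n (a : nat -> C) n : Re (sum_n a n) = sum_n (fun k => Re (a k)) n.
Proof.
  induction n as [|n IH]; [now rewrite !sum_O|]. rewrite Csum_S, sum_Sn, <- IH. reflexivity.
Qed.

Lemma Im_sum_n (a : nat -> C) n : Im (sum_n a n) = sum_n (fun k => Im (a k)) n.
Proof.
  induction n as [|n IH]; [now rewrite !sum_O|]. rewrite Csum_S, sum_Sn, <- IH. reflexivity.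
Qed.

Lemma CV_radius_gt_half (a : nat -> R) (M : R) :
  (forall n, (Rabs (a n) <= M * (11 / 10) ^ n)%R) -> Rbar_lt (/ 2)%R (CV_radius a).
Proof.
  intros H. apply Rbar_lt_le_trans with (10 / 11)%R; [simpl; lra|].
  apply (proj1 (CV_radius_bounded a)). exists M. intros n.
  assert (P : (0 <= (10 / 11) ^ n)%R) by (apply pow_le; lra).
  rewrite Rabs_mult, (Rabs_pos_eq ((10 / 11) ^ n)) by trivial.
  apply Rle_trans with (M * (11 / 10) ^ n * (10 / 11) ^ n)%R;
    [now apply Rmult_le_compat_r|].
  rewrite Rmult_assoc, <- Rpow_mult_distr. replace (11 / 10 * (10 / 11))%R with 1%R by field.
  rewrite pow1. lra.
Qed.

(** The value is (1 - t)^(-s) at t = 1/2. The series is split into real and imaginary power series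
    because the derivative argument is one on a real interval. *)
Lemma binomial_series_half (s : C) : Cser (fun n => saal_q s n * RtoC (/ 2) ^ n) (cpow 2 s).
Proof.
  set (p := fun n => Re (saal_q s n)). set (q := fun n => Im (saal_q s n)).
  destruct (poch_fact_geom s) as [M [_ HM]].
  assert (Rp : Rbar_lt (/ 2)%R (CV_radius p)).
  { apply CV_radius_gt_half with M. intros n. eapply Rle_trans; [apply re_le_Cmod | apply HM]. }
  assert (Rq : Rbar_lt (/ 2)%R (CV_radius q)).
  { apply CV_radius_gt_half with M. intros n. eapply Rle_trans; [apply im_le_Cmod | apply HM]. }
  assert (Hr : forall n, RtoC (INR (S n)) * saal_q s (S n) = (s + RtoC (INR n)) * saal_q s n).
  { intros n. rewrite saal_q_S, RtoC_INR_S. pose proof (RtoC_INR_S_neq_0 n). field. trivial. }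
  assert (Hv : cexp (- (s * RtoC (ln 2))) * (PSeries p (/ 2), PSeries q (/ 2)) = 1).
  { replace (s * RtoC (ln 2)) with ((Re s, Im s) * RtoC (ln 2)) by now destruct s.
    apply PSeries_binomial_half; trivial.
    - intros n. specialize (Hr n). unfold p, q. revert Hr.
      generalize (saal_q s n) (saal_q s (S n)). intros [a b] [c d] E.
      apply (f_equal Re) in E. unfold Re, Im in *. cbn -[INR] in E |- *. lra.
    - intros n. specialize (Hr n). unfold p, q. revert Hr.
      generalize (saal_q s n) (saal_q s (S n)). intros [a b] [c d] E.
      apply (f_equal Im) in E. unfold Re, Im in *. cbn -[INR] in E |- *. lra.
    - unfold p, saal_q. simpl. field.
    - unfold q, saal_q. simpl. field. }
  assert (Ev : cpow 2 s = (PSeries p (/ 2), PSeries q (/ 2))).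
  { rewrite cexp_opp in Hv. unfold cpow. pose proof (cexp_neq_0 (s * RtoC (ln 2))).
    rewrite <- (Cmult_1_r (cexp _)), <- Hv. field. trivial. }
  rewrite Ev. apply Clim_components. split.
  - apply is_lim_seq_ext with (sum_n (fun n => p n * (/ 2) ^ n)%R).
    + intros n. rewrite Re_sum_n. apply sum_n_ext. intros k. rewrite <- RtoC_pow.
      unfold p. simpl. ring.
    + apply (is_pseries_R p). apply PSeries_correct, CV_radius_inside.
      now rewrite Rabs_pos_eq by lra.
  - apply is_lim_seq_ext with (sum_n (fun n => q n * (/ 2) ^ n)%R).
    + intros n. rewrite Im_sum_n. apply sum_n_ext. intros k. rewrite <- RtoC_pow.
      unfold q. simpl. ring.
    + apply (is_pseries_R q). apply PSeries_correct, CV_radius_inside.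
      now rewrite Rabs_pos_eq by lra.
Qed.

Lemma hyp_saal A B G n : ~ nonpos_int G ->
  hyp A B G n = rG G * (saal_p A B G n * RtoC (/ 2) ^ n).
Proof.
  intros HG. unfold hyp, saal_p. rewrite (rG_poch G n).
  pose proof (poch_neq_0 G n HG). pose proof (RtoC_fact_neq_0 n). field. auto.
Qed.

Lemma saal_p_series A B G : ~ nonpos_int G ->
  Cser (fun n => saal_p A B G n * RtoC (/ 2) ^ n) (Gamma G * Hyp A B G).
Proof.
  intros HG. apply Cser_ext with (fun n => Gamma G * hyp A B G n).
  - intros n. rewrite hyp_saal, Gamma_rG by trivial. pose proof (rG_neq_0 G HG).
    field. trivial.
  - apply Cser_scal, Hyp_series.
Qed.

Lemma Cmod_half_pow n : Cmod (RtoC (/ 2) ^ n) = ((/ 2) ^ n)%R.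
Proof. rewrite Cmod_pow, Cmod_R, Rabs_pos_eq; lra. Qed.

Lemma saal_p_geom A B G : ~ nonpos_int G -> exists M, (0 <= M)%R /\
  forall n, (Cmod (saal_p A B G n) <= M * (121 / 100) ^ n)%R.
Proof.
  intros HG. destruct (poch_ratio_geom A G HG) as [M1 [P1 H1]].
  destruct (poch_fact_geom B) as [M2 [P2 H2]].
  exists (M1 * M2)%R. split; [now apply Rmult_le_pos|]. intros n.
  replace (saal_p A B G n) with ((poch A n / poch G n) * (poch B n / RtoC (INR (fact n)))).
  - rewrite Cmod_mult.
    replace ((121 / 100) ^ n)%R with ((11 / 10) ^ n * (11 / 10) ^ n)%R
      by (rewrite <- Rpow_mult_distr; f_equal; field).
    replace (M1 * M2 * ((11 / 10) ^ n * (11 / 10) ^ n))%R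
      with ((M1 * (11 / 10) ^ n) * (M2 * (11 / 10) ^ n))%R by ring.
    apply Rmult_le_compat; trivial; apply Cmod_ge_0.
  - unfold saal_p. pose proof (poch_neq_0 G n HG). pose proof (RtoC_fact_neq_0 n).
    field. auto.
Qed.

(** The series of 2F1(G - A, G - B; G; x) is multiplied by that of (1 - x)^(-s), s = A + B - G. By
    Pfaff-Saalschütz the Cauchy product has the coefficients of 2F1(A, B; G; x), and at x = 1/2 the
    binomial factor is 2^s. *)
Lemma euler_transformation A B G : ~ nonpos_int G ->
  Hyp A B G = cpow 2 (A + B - G) * Hyp (G - A) (G - B) G.
Proof.
  intros HG. set (s := A + B - G).
  set (t := fun i j => (saal_p (G - A) (G - B) G i * RtoC (/ 2) ^ i)
                       * (saal_q s j * RtoC (/ 2) ^ j)).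
  destruct (saal_p_geom (G - A) (G - B) G HG) as [M1 [P1 H1]].
  destruct (poch_fact_geom s) as [M2 [P2 H2]].
  assert (HT : Cser (fun n => sum_n (fun i => t i (n - i)%nat) n)
                 (Gamma G * Hyp (G - A) (G - B) G * cpow 2 s)).
  { apply square_to_triangle with (M1 * M2)%R.
    - intros i j. unfold t. rewrite !Cmod_mult, !Cmod_half_pow, pow_add.
      specialize (H1 i). specialize (H2 j). fold (saal_q s j) in H2.
      assert (Q : forall n, (0 <= (/ 2) ^ n)%R) by (intros; apply pow_le; lra).
      assert (L1 : ((121 / 100) ^ i * (/ 2) ^ i <= (3 / 4) ^ i)%R)
        by (rewrite <- Rpow_mult_distr; apply pow_incr; lra).
      assert (L2 : ((11 / 10) ^ j * (/ 2) ^ j <= (3 / 4) ^ j)%R)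
        by (rewrite <- Rpow_mult_distr; apply pow_incr; lra).
      replace (M1 * M2 * ((3 / 4) ^ i * (3 / 4) ^ j))%R
        with ((M1 * (3 / 4) ^ i) * (M2 * (3 / 4) ^ j))%R by ring.
      apply Rmult_le_compat; try (apply Rmult_le_pos; [apply Cmod_ge_0 | apply Q]).
      + apply Rle_trans with (M1 * (121 / 100) ^ i * (/ 2) ^ i)%R;
          [now apply Rmult_le_compat_r|].
        rewrite Rmult_assoc. now apply Rmult_le_compat_l.
      + apply Rle_trans with (M2 * (11 / 10) ^ j * (/ 2) ^ j)%R;
          [now apply Rmult_le_compat_r|].
        rewrite Rmult_assoc. now apply Rmult_le_compat_l.
    - apply Clim_ext with (fun n =>
        sum_n (fun i => saal_p (G - A) (G - B) G i * RtoC (/ 2) ^ i) n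
        * sum_n (fun j => saal_q s j * RtoC (/ 2) ^ j) n).
      + intros n. rewrite Cmult_comm, <- Csum_scal. apply Csum_ext. intros i _.
        unfold t. rewrite Csum_scal. apply Cmult_comm.
      + apply Clim_mult; [now apply saal_p_series | apply binomial_series_half]. }
  assert (HE : Gamma G * Hyp A B G = Gamma G * Hyp (G - A) (G - B) G * cpow 2 s).
  { apply Cser_unique with (fun n => saal_p A B G n * RtoC (/ 2) ^ n);
      [now apply saal_p_series|].
    eapply Cser_ext; [|exact HT]. intros n. cbv beta.
    pose proof (pfaff_saalschutz (G - A) (G - B) G HG n) as S.
    replace (G - (G - A) - (G - B)) with s in S by (unfold s; ring).
    replace (G - (G - A)) with A in S by ring. replace (G - (G - B)) with B in S by ring.
    unfold saal_p at 1. rewrite <- S, Cmult_comm, <- Csum_scal. apply Csum_ext.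
    intros k Hk. unfold t. replace (RtoC (/ 2) ^ n) with (RtoC (/ 2) ^ k * RtoC (/ 2) ^ (n - k)).
    - ring.
    - rewrite <- Cpow_add_r. f_equal. lia. }
  pose proof (Gamma_neq_0 G HG).
  replace (Hyp A B G) with (/ Gamma G * (Gamma G * Hyp A B G)) by (field; trivial).
  rewrite HE. field. trivial.
Qed.

(** * Contiguous relations *)

Lemma Cser_telescope (a g : nat -> C) :
  (forall N, sum_n a N = g N) -> Clim g 0 -> Cser a 0.
Proof. intros H. apply Clim_ext. intros n. now rewrite H. Qed.

Lemma Clim_0_scal (k : C) (u : nat -> C) : Clim u 0 -> Clim (fun n => k * u n) 0.
Proof. intros H. replace (RtoC 0) with (k * 0) by ring. now apply Clim_scal. Qed.

(** The factor 1/2 is the argument z in F(a + 1, b; c) - F(a, b; c) = z (b/c) F(a + 1, b + 1; c +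
    1). The difference of the left terms at n is the shifted term at n - 1, so partial sums leave
    only one term, which tends to 0. *)
Lemma Hyp_contig_a A B G :
  Hyp (A + 1) B G = Hyp A B G + B / 2 * Hyp (A + 1) (B + 1) (G + 1).
Proof.
  assert (H : Hyp (A + 1) B G + (-(1) * Hyp A B G + - (B / 2) * Hyp (A + 1) (B + 1) (G + 1)) = 0).
  { eapply Cser_unique.
    - apply Cser_plus; [apply Hyp_series|].
      apply Cser_plus; apply Cser_scal; apply Hyp_series.
    - apply Cser_telescope with (fun N => - (B / 2) * hyp (A + 1) (B + 1) (G + 1) N);
        [|apply Clim_0_scal, hyp_lim_0].
      induction N as [|N IH].
      + rewrite Csum_0. unfold hyp. simpl. toC. field.
      + rewrite Csum_S, IH. unfold hyp. rewrite (poch_S_l A), (poch_S_l B), poch_S.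
        rewrite RtoC_fact_S, RtoC_INR_S. simpl Cpow.
        replace (G + 1 + RtoC (INR N)) with (G + (RtoC (INR N) + 1)) by ring.
        rewrite RtoC_inv by lra.
        pose proof (RtoC_fact_neq_0 N). pose proof (RtoC_INR_S_neq_0 N). toC. field. auto. }
  replace (Hyp (A + 1) B G) with
    (Hyp (A + 1) B G + (-(1) * Hyp A B G + - (B / 2) * Hyp (A + 1) (B + 1) (G + 1))
     + (Hyp A B G + B / 2 * Hyp (A + 1) (B + 1) (G + 1))) by ring.
  rewrite H. ring.
Qed.

(** Here the factor 1/2 is 1 - z rather than z; at z = 1/2 the boundary term of the telescoping is
    the same as for [Hyp_contig_a]. *)
Lemma Hyp_contig_ac A B G :
  (G - B) * Hyp (A + 1) B (G + 1) = Hyp A B G - B / 2 * Hyp (A + 1) (B + 1) (G + 1).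
Proof.
  assert (H : (G - B) * Hyp (A + 1) B (G + 1)
    + (-(1) * Hyp A B G + (B / 2) * Hyp (A + 1) (B + 1) (G + 1)) = 0).
  { eapply Cser_unique.
    - apply Cser_plus; [apply Cser_scal, Hyp_series|].
      apply Cser_plus; apply Cser_scal; apply Hyp_series.
    - apply Cser_telescope with (fun N => - (B / 2) * hyp (A + 1) (B + 1) (G + 1) N);
        [|apply Clim_0_scal, hyp_lim_0].
      induction N as [|N IH].
      + rewrite Csum_0. unfold hyp. simpl. rewrite (rG_rec (G + 0)), !Cplus_0_r. toC. field.
      + rewrite Csum_S, IH. unfold hyp. rewrite (poch_S_l A), (poch_S_l B), !poch_S.
        rewrite RtoC_fact_S, RtoC_INR_S. simpl Cpow.
        replace (G + 1 + RtoC (INR N)) with (G + (RtoC (INR N) + 1)) by ring.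
        rewrite (rG_rec (G + (RtoC (INR N) + 1))).
        replace (G + (RtoC (INR N) + 1) + 1) with (G + 1 + (RtoC (INR N) + 1)) by ring.
        rewrite RtoC_inv by lra.
        pose proof (RtoC_fact_neq_0 N). pose proof (RtoC_INR_S_neq_0 N). toC. field. auto. }
  replace ((G - B) * Hyp (A + 1) B (G + 1)) with
    ((G - B) * Hyp (A + 1) B (G + 1)
     + (-(1) * Hyp A B G + (B / 2) * Hyp (A + 1) (B + 1) (G + 1))
     + (Hyp A B G - B / 2 * Hyp (A + 1) (B + 1) (G + 1))) by ring.
  rewrite H. ring.
Qed.

(* The hypergeometric differential equation at 1/2: when 2G = A + B + 1 its first-order
   term vanishes there, so F''(1/2) is a multiple of F(1/2). *)
Lemma Hyp_shift2 A B G : 2 * G = A + B + 1 ->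
  4 * Hyp A B G = (A + 1) * (B + 1) * Hyp (A + 2) (B + 2) (G + 2).
Proof.
  intros HG.
  assert (EB : B = 2 * G - A - 1) by (rewrite HG; ring).
  assert (H : 4 * Hyp A B G + - ((A + 1) * (B + 1)) * Hyp (A + 2) (B + 2) (G + 2) = 0).
  { eapply Cser_unique.
    - apply Cser_plus; apply Cser_scal; apply Hyp_series.
    (* The differential equation yields this identity multiplied by A B. Telescoping proves it
       without that factor, so A = 0 and B = 0 are no exceptions; the three terms are the boundary
       at the upper end. *)
    - apply Cser_telescope with (fun N =>
        2 * G * hyp (A + 1) (B + 1) (G + 1) N
        + (2 * hyp (A + 1) (B + 1) G N
           + - ((A + 1) * (B + 1)) * hyp (A + 2) (B + 2) (G + 2) N)).
      2:{ replace (RtoC 0) with (0 + (0 + 0)) by ring.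
          apply Clim_plus; [|apply Clim_plus]; apply Clim_0_scal, hyp_lim_0. }
      induction N as [|N IH].
      + rewrite Csum_0. unfold hyp. simpl. rewrite (rG_rec (G + 0)), !Cplus_0_r. toC. field.
      + rewrite Csum_S, IH.
        (* This gives all terms the common factors [poch (A + 1) N] and [poch (B + 1) N] without
           dividing by A + 1 or B + 1. *)
        assert (E2 : forall x, (x + 1) * poch (x + 2) N = poch (x + 1) N * (x + 1 + RtoC (INR N))).
        { intros x. rewrite <- poch_S, poch_S_l. do 2 f_equal. ring. }
        assert (E3 : (A + 1) * (B + 1) * hyp (A + 2) (B + 2) (G + 2) N =
          poch (A + 1) N * (A + 1 + RtoC (INR N)) * (poch (B + 1) N * (B + 1 + RtoC (INR N)))
          * rG (G + 2 + RtoC (INR N)) / RtoC (INR (fact N)) * RtoC (/ 2) ^ N).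
        { unfold hyp. rewrite <- !E2. unfold Cdiv. ring. }
        replace (- ((A + 1) * (B + 1)) * hyp (A + 2) (B + 2) (G + 2) N)
          with (- ((A + 1) * (B + 1) * hyp (A + 2) (B + 2) (G + 2) N)) by ring.
        rewrite E3.
        unfold hyp at 1 2 3 5 6. rewrite (poch_S_l A), (poch_S_l B), !poch_S.
        rewrite RtoC_fact_S, RtoC_INR_S. simpl Cpow.
        replace (G + (RtoC (INR N) + 1)) with (G + 1 + RtoC (INR N)) by ring.
        rewrite (rG_rec (G + RtoC (INR N))).
        replace (G + RtoC (INR N) + 1) with (G + 1 + RtoC (INR N)) by ring.
        rewrite !(rG_rec (G + 1 + RtoC (INR N))).
        replace (G + 1 + (RtoC (INR N) + 1)) with (G + 2 + RtoC (INR N)) by ring.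
        replace (G + 1 + RtoC (INR N) + 1) with (G + 2 + RtoC (INR N)) by ring.
        rewrite RtoC_inv by lra.
        generalize (hyp (A + 2) (B + 2) (G + 2) (S N)). intros hS.
        rewrite EB.
        pose proof (RtoC_fact_neq_0 N). pose proof (RtoC_INR_S_neq_0 N). toC. field. auto. }
  replace (4 * Hyp A B G) with
    (4 * Hyp A B G + - ((A + 1) * (B + 1)) * Hyp (A + 2) (B + 2) (G + 2)
     + (A + 1) * (B + 1) * Hyp (A + 2) (B + 2) (G + 2)) by ring.
  rewrite H. ring.
Qed.

(** * Gauss' second summation theorem and its generalisations *)

Lemma Clim_Cmod_le (u : nat -> C) (l c : C) (b : R) :
  Clim u l -> (forall n, (Cmod (u n - c) <= b)%R) -> (Cmod (l - c) <= b)%R.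
Proof.
  intros H Hb.
  apply (is_lim_seq_le (fun _ => Cmod (l - c)) (fun n => Cmod (u n - l) + b)%R
           (Cmod (l - c)) b).
  - intros n. replace (l - c) with (- (u n - l) + (u n - c)) by ring.
    eapply Rle_trans; [apply Cmod_triangle|]. rewrite Cmod_opp. specialize (Hb n). lra.
  - apply is_lim_seq_const.
  - replace (Finite b) with (Finite (0 + b)) by (f_equal; ring).
    apply is_lim_seq_plus'; [exact H | apply is_lim_seq_const].
Qed.

Lemma Re_pos_not_nonpos_int (z : C) : (0 < Re z)%R -> ~ nonpos_int z.
Proof. intros H [k Hk]. rewrite Hk in H. simpl in H. pose proof (pos_INR k). lra. Qed.

Lemma Re_le_Cmod (z : C) : (Re z <= Cmod z)%R.
Proof. eapply Rle_trans; [apply Rle_abs | apply re_le_Cmod]. Qed.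

(** Since |q| <= Re c, every factor |q + n| / |c + n| is at most 1; only the first one is kept. *)
Lemma poch_ratio_le (q c : C) n : (0 < Re c)%R -> (Cmod q <= Re c)%R ->
  (Cmod (poch q (S n) / poch c (S n)) <= Cmod q / Cmod c)%R.
Proof.
  intros Hc Hq. pose proof (Re_pos_not_nonpos_int c Hc) as Nc.
  pose proof (Re_le_Cmod c).
  induction n as [|n IH].
  - right. rewrite !poch_S. simpl poch. change (INR 0) with 0%R.
    rewrite !Cplus_0_r, !Cmult_1_l. apply Cmod_div, nonpos_int_neq_0; trivial.
  - eapply Rle_trans; [|exact IH].
    pose proof (poch_neq_0 c (S n) Nc). pose proof (nonpos_int_shift c (S n) Nc) as N1.
    rewrite (poch_S q (S n)), (poch_S c (S n)).
    replace (poch q (S n) * (q + RtoC (INR (S n))) / (poch c (S n) * (c + RtoC (INR (S n)))))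
      with ((q + RtoC (INR (S n))) / (c + RtoC (INR (S n))) * (poch q (S n) / poch c (S n)))
      by (field; auto).
    rewrite Cmod_mult. rewrite <- (Rmult_1_l (Cmod (poch q (S n) / poch c (S n)))) at 2.
    apply Rmult_le_compat_r; [apply Cmod_ge_0|]. rewrite Cmod_div by trivial.
    apply (proj1 (Cmod_gt_0 _)) in N1.
    apply Rmult_le_reg_r with (Cmod (c + RtoC (INR (S n)))); trivial.
    unfold Rdiv. rewrite Rmult_assoc, Rinv_l, Rmult_1_r, Rmult_1_l by lra.
    apply Rle_trans with (Cmod q + INR (S n))%R.
    + eapply Rle_trans; [apply Cmod_triangle|]. pose proof (pos_INR (S n)).
      rewrite Cmod_R, Rabs_pos_eq; lra.
    + apply Rle_trans with (Re (c + RtoC (INR (S n)))); [|apply Re_le_Cmod].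
      change (Cmod q + INR (S n) <= Re c + INR (S n))%R. lra.
Qed.

(** Every term after the first carries the factor |q| / |c|, and what remains is dominated by a
    geometric series of ratio 11/20. Its sum 11/9 is rounded up to 3. The point is that [M] does not
    depend on [c]. *)
Lemma gauss_series_near_1 (p q : C) : exists M, (0 <= M)%R /\
  forall c, (0 < Re c)%R -> (Cmod q <= Re c)%R ->
    (Cmod (Gamma c * Hyp p q c - 1) <= M / Cmod c)%R.
Proof.
  destruct (poch_fact_geom p) as [M [PM HM]].
  exists (3 * M * Cmod q)%R. pose proof (Cmod_ge_0 q) as Pq.
  split; [apply Rmult_le_pos; lra|]. intros c Hc Hq.
  pose proof (Re_pos_not_nonpos_int c Hc) as Nc.
  assert (Pc : (0 < Cmod c)%R) by (pose proof (Re_le_Cmod c); lra).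
  apply Clim_Cmod_le with (sum_n (fun n => saal_p p q c n * RtoC (/ 2) ^ n));
    [now apply saal_p_series|].
  set (k := (Cmod q / Cmod c * M)%R).
  assert (Pk : (0 <= k)%R).
  { apply Rmult_le_pos; trivial. apply Rmult_le_pos; trivial.
    left; now apply Rinv_0_lt_compat. }
  intros n. apply Rle_trans with (3 * k * (1 - (11 / 20) ^ n))%R.
  - induction n as [|n IH].
    + rewrite Csum_0. unfold saal_p. simpl.
      replace (1 * 1 / (1 * 1) * 1 - 1) with (RtoC 0) by field. rewrite Cmod_0. lra.
    + rewrite Csum_S.
      match goal with |- (Cmod (Cminus (Cplus ?s ?x) _) <= _)%R =>
        replace (s + x - 1) with ((s - 1) + x) by (toC; ring) end.
      eapply Rle_trans; [apply Cmod_triangle|].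
      assert (Hx : (Cmod (saal_p p q c (S n) * RtoC (/ 2) ^ S n) <= k * (11 / 20) ^ S n)%R).
      { replace (saal_p p q c (S n)) with
          (poch q (S n) / poch c (S n) * (poch p (S n) / RtoC (INR (fact (S n))))).
        - rewrite !Cmod_mult, Cmod_half_pow.
          pose proof (poch_ratio_le q c n Hc Hq). specialize (HM (S n)).
          replace ((11 / 20) ^ S n)%R with ((11 / 10) ^ S n * (/ 2) ^ S n)%R
            by (rewrite <- Rpow_mult_distr; f_equal; field).
          unfold k.
          replace (Cmod q / Cmod c * M * ((11 / 10) ^ S n * (/ 2) ^ S n))%R
            with ((Cmod q / Cmod c * (M * (11 / 10) ^ S n)) * (/ 2) ^ S n)%R by ring.
          apply Rmult_le_compat_r; [apply pow_le; lra|].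
          apply Rmult_le_compat; trivial; apply Cmod_ge_0.
        - unfold saal_p. pose proof (poch_neq_0 c (S n) Nc).
          pose proof (RtoC_fact_neq_0 (S n)). field. auto. }
      eapply Rle_trans; [apply Rplus_le_compat; [exact IH | exact Hx]|].
      simpl. assert (0 <= k * (11 / 20) ^ n)%R by (apply Rmult_le_pos; trivial; apply pow_le; lra).
      lra.
  - replace (3 * M * Cmod q / Cmod c)%R with (3 * k * 1)%R by (unfold k; field; lra).
    apply Rmult_le_compat_l; [lra|].
    assert (0 <= (11 / 20) ^ n)%R by (apply pow_le; lra). lra.
Qed.

Lemma RtoC_INR_double k : RtoC (INR (2 * k)) = 2 * RtoC (INR k).
Proof. rewrite mult_INR, RtoC_mult. reflexivity. Qed.

Lemma gauss_series_lim_1 (p q G : C) :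
  Clim (fun k => Gamma (G + RtoC (INR (2 * k))) * Hyp p q (G + RtoC (INR (2 * k)))) 1.
Proof.
  destruct (gauss_series_near_1 p q) as [M [PM HM]].
  destruct (nfloor_ex (Cmod q + Cmod G + 1)) as [N [_ HN]];
    [pose proof (Cmod_ge_0 q); pose proof (Cmod_ge_0 G); lra|].
  apply Clim_squeeze with (fun k => M * / (INR k + INR 1))%R (S N).
  - intros k Hk. apply le_INR in Hk. rewrite S_INR in Hk.
    assert (HG : (- Cmod G <= Re G)%R).
    { pose proof (re_le_Cmod G) as H. apply Rabs_le_between in H. lra. }
    pose proof (Cmod_ge_0 q). pose proof (Cmod_ge_0 G).
    assert (HR : (Re (G + RtoC (INR (2 * k))) = Re G + 2 * INR k)%R).
    { rewrite mult_INR. reflexivity. }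
    eapply Rle_trans; [apply HM; rewrite HR; lra|].
    apply Rmult_le_compat_l; trivial. pose proof (pos_INR N). change (INR 1) with 1%R.
    apply Rinv_le_contravar; [lra|].
    eapply Rle_trans; [|apply Re_le_Cmod]. rewrite HR. lra.
  - replace (Finite 0) with (Finite (M * 0)) by (f_equal; ring).
    apply is_lim_seq_mult'; [apply is_lim_seq_const | apply is_lim_seq_inv_INR].
Qed.

Lemma cpow_2_double k : cpow 2 (RtoC (INR (2 * k))) = 4 ^ k.
Proof.
  induction k as [|k IH]; [unfold cpow; simpl; rewrite Cmult_0_l; apply cexp_0|].
  replace (2 * S k)%nat with (S (S (2 * k))) by lia.
  rewrite !RtoC_INR_S, !cpow_plus, IH, cpow_1 by lra. simpl Cpow. ring.
Qed.

Lemma poch_double z k :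
  poch z (2 * k) = 4 ^ k * poch (z / 2) k * poch ((z + 1) / 2) k.
Proof.
  induction k as [|k IH]; [simpl; ring|].
  replace (2 * S k)%nat with (S (S (2 * k))) by lia.
  rewrite !poch_S, IH, RtoC_INR_S, RtoC_INR_double. simpl Cpow. field.
Qed.

(** The condition on [G] survives the shift of all three parameters by 2, so [Hyp_shift2] can be
    iterated; the factors 1/4 turn its coefficients into Pochhammer symbols with halved
    arguments. *)
Lemma Hyp_shift_double A B G k : 2 * G = A + B + 1 ->
  Hyp A B G = poch ((A + 1) / 2) k * poch ((B + 1) / 2) k *
    Hyp (A + RtoC (INR (2 * k))) (B + RtoC (INR (2 * k))) (G + RtoC (INR (2 * k))).
Proof.
  intros HG. induction k as [|k IH].
  - simpl. rewrite !Cplus_0_r. ring.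
  - rewrite IH.
    replace (2 * S k)%nat with (S (S (2 * k))) by lia. rewrite !RtoC_INR_S.
    set (e := RtoC (INR (2 * k))) in *.
    assert (H := Hyp_shift2 (A + e) (B + e) (G + e)).
    replace (A + (e + 1 + 1)) with (A + e + 2) by ring.
    replace (B + (e + 1 + 1)) with (B + e + 2) by ring.
    replace (G + (e + 1 + 1)) with (G + e + 2) by ring.
    replace (Hyp (A + e) (B + e) (G + e)) with
      ((A + e + 1) * (B + e + 1) * Hyp (A + e + 2) (B + e + 2) (G + e + 2) / 4).
    + rewrite !poch_S. unfold e. rewrite RtoC_INR_double. field.
    + rewrite <- H; [field|].
      replace (2 * (G + e)) with (2 * G + 2 * e) by ring. rewrite HG. ring.
Qed.

(** An exact form of the asymptotics (x)_n / (y)_n ~ Gamma(y)/Gamma(x) n^(x - y). *)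
Lemma poch_ratio_rgs x y n : ~ nonpos_int y ->
  poch x (S n) / poch y (S n) = rgs x n / rgs y n * cpow (INR n) (x - y).
Proof.
  intros Hy. unfold rgs, Cminus. rewrite cpow_plus, cpow_opp.
  pose proof (RtoC_fact_neq_0 n). pose proof (cpow_neq_0 (INR n) x).
  pose proof (cpow_neq_0 (INR n) y). pose proof (poch_neq_0 y (S n) Hy). field. auto.
Qed.

(** A Pochhammer symbol of order k belongs to [rgs] at index k - 1; orders k and 2k with k = n + 2
    give these two indices. *)
Lemma is_lim_seq_ln_ratio :
  is_lim_seq (fun n => ln (INR (S n)) - ln (INR (2 * S n + 1)))%R (- ln 2)%R.
Proof.
  apply is_lim_seq_ext with (fun n => - ln (2 + / (INR n + INR 1)))%R.
  - intros n. pose proof (pos_INR n). rewrite plus_INR, mult_INR.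
    change (INR 1) with 1%R. change (INR 2) with 2%R. rewrite S_INR.
    assert (0 < / (INR n + 1))%R by (apply Rinv_0_lt_compat; lra).
    rewrite <- ln_div, <- ln_Rinv by lra.
    f_equal. field. lra.
  - apply (is_lim_seq_opp _ (Finite (ln 2))).
    apply (is_lim_seq_continuous ln).
    + apply derivable_continuous_pt, ex_derive_Reals_0. auto_derive; lra.
    + replace (Finite 2) with (Finite (2 + 0)) by now rewrite Rplus_0_r.
      apply is_lim_seq_plus'; [apply is_lim_seq_const | apply is_lim_seq_inv_INR].
Qed.

Lemma filterlim_2n1 : filterlim (fun n => (2 * n + 1)%nat) eventually eventually.
Proof. apply eventually_subseq. intros n. lia. Qed.

Lemma half_not_nonpos_int B : ~ nonpos_int B -> ~ nonpos_int (B / 2).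
Proof.
  intros H [k Hk]. apply H. exists (2 * k)%nat.
  replace B with (2 * (B / 2)) by field. rewrite Hk, <- RtoC_mult, mult_INR.
  simpl INR. f_equal. ring.
Qed.

(** For every k the value is a constant times (a)_k / (B/2)_k, times (B)_2k / (G)_2k, times a series
    tending to 1, where a = (A + 1)/2. These quotients grow like k^e and (2k)^(-e) with e = a - B/2,
    so the powers of k cancel and 2^(-e) remains. *)
Lemma gauss_second_regular A B G : 2 * G = A + B + 1 -> ~ nonpos_int B -> ~ nonpos_int G ->
  Gamma B * Hyp A B G = cpow 2 (B - 1) * Gamma (B / 2) * rG ((A + 1) / 2).
Proof.
  intros HG HB NG. pose proof (half_not_nonpos_int B HB) as HB2.
  set (a := (A + 1) / 2). set (e := a - B / 2).
  assert (Ee : B - G = - e).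
  { unfold e, a. replace G with (2 * G / 2) by field. rewrite HG. field. }
  assert (H1 : Clim (fun n => poch a (S (S n)) / poch (B / 2) (S (S n))
      * (poch B (2 * S (S n)) / poch G (2 * S (S n))))
      (rG a / rG (B / 2) * (rG B / rG G) * cexp (e * RtoC (- ln 2)))).
  { apply Clim_ext with (fun n => rgs a (S n) / rgs (B / 2) (S n)
      * (rgs B (2 * S n + 1) / rgs G (2 * S n + 1))
      * cexp (e * RtoC (ln (INR (S n)) - ln (INR (2 * S n + 1))))).
    - intros n. replace (2 * S (S n))%nat with (S (2 * S n + 1)) by lia.
      rewrite !poch_ratio_rgs by trivial. rewrite Ee. fold e.
      rewrite RtoC_minus. unfold cpow.
      replace (e * (RtoC (ln (INR (S n))) - RtoC (ln (INR (2 * S n + 1)))))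
        with (e * RtoC (ln (INR (S n))) + - e * RtoC (ln (INR (2 * S n + 1)))) by ring.
      rewrite cexp_plus. ring.
    - apply Clim_mult; [|apply Clim_cexp_scal, is_lim_seq_ln_ratio].
      apply Clim_mult; apply Clim_mult.
      + apply Clim_incr_1, rG_lim.
      + apply (Clim_incr_1 (fun n => / rgs (B / 2) n)), Clim_inv;
          [now apply rG_neq_0 | apply rG_lim].
      + apply (Clim_incr_1 (fun n => rgs B (2 * n + 1))).
        apply (Clim_subseq (fun n => (2 * n + 1)%nat)); [apply filterlim_2n1 | apply rG_lim].
      + apply (Clim_incr_1 (fun n => / rgs G (2 * n + 1))), Clim_inv; [now apply rG_neq_0|].
        apply (Clim_subseq (fun n => (2 * n + 1)%nat)); [apply filterlim_2n1 | apply rG_lim]. }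
  assert (H2 : Hyp A B G = cpow 2 (A + B - G) * rG G *
    (rG a / rG (B / 2) * (rG B / rG G) * cexp (e * RtoC (- ln 2)) * 1)).
  { apply Clim_unique with (fun _ : nat => Hyp A B G); [apply Clim_const|].
    eapply Clim_ext; [|apply Clim_scal, Clim_mult;
      [exact H1 | apply (Clim_incr_1 (fun n => Gamma (G + RtoC (INR (2 * S n)))
         * Hyp (G - A) (G - B) (G + RtoC (INR (2 * S n))))),
         (Clim_incr_1 (fun n => Gamma (G + RtoC (INR (2 * n)))
         * Hyp (G - A) (G - B) (G + RtoC (INR (2 * n))))), gauss_series_lim_1]].
    intros n. cbv beta. rewrite (Hyp_shift_double A B G (S (S n)) HG).
    set (k := S (S n)).
    pose proof (nonpos_int_plus G (2 * k) NG) as NGk.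
    rewrite (euler_transformation (A + _) (B + _) (G + _)) by trivial.
    rewrite (rG_poch G (2 * k)), (Gamma_rG (G + _)) by trivial.
    replace (G + RtoC (INR (2 * k)) - (A + RtoC (INR (2 * k)))) with (G - A) by ring.
    replace (G + RtoC (INR (2 * k)) - (B + RtoC (INR (2 * k)))) with (G - B) by ring.
    replace (A + RtoC (INR (2 * k)) + (B + RtoC (INR (2 * k))) - (G + RtoC (INR (2 * k))))
      with (A + B - G + RtoC (INR (2 * k))) by ring.
    rewrite cpow_plus, cpow_2_double, (poch_double B). fold a.
    pose proof (rG_neq_0 _ NGk). pose proof (poch_neq_0 G (2 * k) NG).
    pose proof (poch_neq_0 (B / 2) k HB2). field. auto. }
  rewrite H2, !Gamma_rG by trivial.
  replace (cexp (e * RtoC (- ln 2))) with (cpow 2 (B - G))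
    by (unfold cpow; rewrite Ee, RtoC_opp; f_equal; ring).
  replace (B - 1) with ((A + B - G) + (B - G)).
  - rewrite cpow_plus. pose proof (rG_neq_0 B HB). pose proof (rG_neq_0 _ HB2).
    pose proof (rG_neq_0 G NG). unfold a. field. auto.
  - replace (A + B - G + (B - G)) with (A + 2 * B - 2 * G) by ring. rewrite HG. ring.
Qed.

(* Shifting by a large even integer moves [G] away from the poles of [Gamma]. *)
Lemma gauss_second A B G : 2 * G = A + B + 1 -> ~ nonpos_int B ->
  Gamma B * Hyp A B G = cpow 2 (B - 1) * Gamma (B / 2) * rG ((A + 1) / 2).
Proof.
  intros HG HB. pose proof (half_not_nonpos_int B HB) as HB2.
  destruct (nfloor_ex (Cmod G) (Cmod_ge_0 G)) as [N [_ HN]].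
  set (k := S N). set (d := RtoC (INR (2 * k))).
  assert (NG : ~ nonpos_int (G + d)).
  { apply Re_pos_not_nonpos_int. unfold d, k. rewrite mult_INR, (S_INR N).
    change (0 < Re G + 2 * (INR N + 1))%R.
    pose proof (re_le_Cmod G) as H. apply Rabs_le_between in H. pose proof (pos_INR N). lra. }
  assert (H := gauss_second_regular (A + d) (B + d) (G + d)).
  rewrite (Hyp_shift_double A B G k HG). fold d.
  specialize (H ltac:(replace (2 * (G + d)) with (2 * G + 2 * d) by ring; rewrite HG; ring)
                (nonpos_int_plus B (2 * k) HB) NG).
  pose proof (poch_double B k) as Ed.
  assert (Hb : poch ((B + 1) / 2) k <> 0).
  { intros E. rewrite E, Cmult_0_r in Ed. exact (poch_neq_0 B (2 * k) HB Ed). }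
  unfold d in H at 1. rewrite (Gamma_poch B (2 * k) HB), Ed in H.
  replace ((B + d) / 2) with (B / 2 + RtoC (INR k)) in H
    by (unfold d; rewrite RtoC_INR_double; field).
  rewrite (Gamma_poch (B / 2) k HB2) in H.
  rewrite (rG_poch ((A + 1) / 2) k).
  replace ((A + d + 1) / 2) with ((A + 1) / 2 + RtoC (INR k)) in H
    by (unfold d; rewrite RtoC_INR_double; field).
  assert (E4 : cpow 2 (B + d - 1) = cpow 2 (B - 1) * 4 ^ k).
  { replace (B + d - 1) with (B - 1 + d) by ring. rewrite cpow_plus. f_equal.
    apply cpow_2_double. }
  rewrite E4 in H.
  pose proof (poch_neq_0 (B / 2) k HB2).
  assert (H4 : (4 ^ k)%C <> 0).
  { rewrite <- RtoC_pow. apply RtoC_neq_0, pow_nonzero. lra. }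
  set (W := Hyp (A + d) (B + d) (G + d)) in *.
  replace (Gamma B * (poch ((A + 1) / 2) k * poch ((B + 1) / 2) k * W)) with
    (4 ^ k * poch (B / 2) k * poch ((B + 1) / 2) k * Gamma B * W
     * poch ((A + 1) / 2) k / (4 ^ k * poch (B / 2) k)) by (field; auto).
  rewrite H. field. auto.
Qed.

(** * Pascal's rule and the summation theorems for all [i] *)

Lemma C_n_0 n : Binomial.C n 0 = 1%R.
Proof.
  unfold Binomial.C. rewrite Nat.sub_0_r. simpl. field. apply INR_fact_neq_0.
Qed.

Lemma C_n_n n : Binomial.C n n = 1%R.
Proof.
  unfold Binomial.C. rewrite Nat.sub_diag. simpl. field. apply INR_fact_neq_0.
Qed.

Lemma Csum_shift (f : nat -> C) n : sum_n f (S n) = f 0%nat + sum_n (fun k => f (S k)) n.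
Proof.
  induction n as [|n IH]; [now rewrite Csum_S, !Csum_0|].
  rewrite Csum_S, IH, Csum_S. toC; ring.
Qed.

Lemma sum_pascal (f : nat -> C) i :
  sum_n (fun r => cbinom (S i) r * f r) (S i) =
  sum_n (fun r => cbinom i r * f r) i + sum_n (fun r => cbinom i r * f (S r)) i.
Proof.
  destruct i as [|i].
  - rewrite Csum_S, !Csum_0. unfold cbinom. rewrite !C_n_0, C_n_n. toC; ring.
  - rewrite Csum_shift, (Csum_shift (fun r => cbinom (S i) r * f r)).
    rewrite (Csum_S (fun k => cbinom (S (S i)) (S k) * f (S k))).
    rewrite (Csum_S (fun r => cbinom (S i) r * f (S r))).
    rewrite (Csum_ext (fun k => cbinom (S (S i)) (S k) * f (S k))
      (fun k => cbinom (S i) (S k) * f (S k) + cbinom (S i) k * f (S k))), Csum_plus.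
    + unfold cbinom. rewrite !C_n_0, !C_n_n. toC; ring.
    + intros k Hk. unfold cbinom. rewrite <- pascal by lia. rewrite RtoC_plus. toC; ring.
Qed.

(** The induction uses (x, B) and (x + 1, B + 1): the r-th summand for the latter is the (r + 1)-st
    for the former, which is the second sum in Pascal's rule. The coefficient B/2 of the contiguous
    relation is cancelled by Gamma(B + 1) = B Gamma(B) and by the doubling of 2^(B - 1). *)
Lemma gauss_second_minus i : forall x B, ~ nonpos_int B ->
  Gamma B * Hyp (x + RtoC (INR i)) B ((x + B + 1) / 2) =
  cpow 2 (B - 1) * sum_n (fun r => cbinom i r *
    (Gamma ((B + RtoC (INR r)) / 2) * rG ((x + 1 + RtoC (INR r)) / 2))) i.
Proof.
  induction i as [|i IH]; intros x B HB.
  - rewrite Csum_0. unfold cbinom. rewrite C_n_0. change (INR 0) with 0%R.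
    rewrite !Cplus_0_r, gauss_second; trivial; [ring | field].
  - rewrite sum_pascal, RtoC_INR_S, Cplus_assoc, Hyp_contig_a.
    pose proof (IH x B HB) as E1.
    pose proof (IH (x + 1) (B + 1) (nonpos_int_plus_1 B HB)) as E2.
    rewrite Gamma_rec in E2 by trivial.
    replace (x + 1 + RtoC (INR i)) with (x + RtoC (INR i) + 1) in E2 by ring.
    replace ((x + 1 + (B + 1) + 1) / 2) with ((x + B + 1) / 2 + 1) in E2 by field.
    replace (B + 1 - 1) with (B - 1 + 1) in E2 by ring.
    rewrite cpow_plus, cpow_1 in E2 by lra.
    rewrite (Csum_ext _ (fun r => cbinom i r * (Gamma ((B + RtoC (INR (S r))) / 2)
      * rG ((x + 1 + RtoC (INR (S r))) / 2)))) in E2.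
    + rewrite Cmult_plus_distr_l, E1, Cmult_plus_distr_l. f_equal.
      match goal with |- ?l = _ => replace l with
        (B * Gamma B * Hyp (x + RtoC (INR i) + 1) (B + 1) ((x + B + 1) / 2 + 1) / 2) by field end.
      rewrite E2. toC; field.
    + intros r _. rewrite RtoC_INR_S. do 3 f_equal; f_equal; ring.
Qed.

(** The minus sign in [Hyp_contig_ac] produces (-1)^r, and its factors G - B with G = (x + B + 1)/2
    + i accumulate to the Pochhammer symbol on the left. *)
Lemma gauss_second_plus i : forall x B, ~ nonpos_int B ->
  poch ((x + 1 - B) / 2) i * Gamma B * Hyp (x + RtoC (INR i)) B ((x + B + 1) / 2 + RtoC (INR i)) =
  cpow 2 (B - 1) * sum_n (fun r => cbinom i r * (RtoC ((-1) ^ r) *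
    (Gamma ((B + RtoC (INR r)) / 2) * rG ((x + 1 + RtoC (INR r)) / 2)))) i.
Proof.
  induction i as [|i IH]; intros x B HB.
  - rewrite Csum_0. unfold cbinom. rewrite C_n_0. change (INR 0) with 0%R.
    rewrite !Cplus_0_r. simpl poch. rewrite Cmult_1_l, gauss_second; trivial; [|field].
    simpl pow. ring.
  - rewrite sum_pascal, RtoC_INR_S, !Cplus_assoc, poch_S.
    pose proof (IH x B HB) as E1.
    pose proof (IH (x + 1) (B + 1) (nonpos_int_plus_1 B HB)) as E2.
    pose proof (Hyp_contig_ac (x + RtoC (INR i)) B ((x + B + 1) / 2 + RtoC (INR i))) as E3.
    rewrite Gamma_rec in E2 by trivial.
    replace (x + 1 + RtoC (INR i)) with (x + RtoC (INR i) + 1) in E2 by ring.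
    replace ((x + 1 + (B + 1) + 1) / 2 + RtoC (INR i))
      with ((x + B + 1) / 2 + RtoC (INR i) + 1) in E2 by field.
    replace ((x + 1 + 1 - (B + 1)) / 2) with ((x + 1 - B) / 2) in E2 by field.
    replace (B + 1 - 1) with (B - 1 + 1) in E2 by ring.
    rewrite cpow_plus, cpow_1 in E2 by lra.
    rewrite (Csum_ext _ (fun r => -(1) * (cbinom i r * (RtoC ((-1) ^ S r) *
      (Gamma ((B + RtoC (INR (S r))) / 2) * rG ((x + 1 + RtoC (INR (S r))) / 2)))))),
      Csum_scal in E2.
    + set (h0 := Hyp (x + RtoC (INR i)) B ((x + B + 1) / 2 + RtoC (INR i))) in *.
      set (h1 := Hyp (x + RtoC (INR i) + 1) B ((x + B + 1) / 2 + RtoC (INR i) + 1)) in *.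
      set (h2 := Hyp (x + RtoC (INR i) + 1) (B + 1) ((x + B + 1) / 2 + RtoC (INR i) + 1)) in *.
      replace (((x + 1 - B) / 2 + RtoC (INR i))) with ((x + B + 1) / 2 + RtoC (INR i) - B) by field.
      set (g := poch ((x + 1 - B) / 2) i) in *.
      match goal with |- g * ?k * _ * _ = _ =>
        replace (g * k * Gamma B * h1) with (g * Gamma B * (k * h1)) by ring end.
      rewrite E3.
      replace (g * Gamma B * (h0 - B / 2 * h2)) with
        (g * Gamma B * h0 - g * (B * Gamma B) * h2 / 2) by field.
      rewrite E1, E2. toC; field.
    + intros r _. rewrite RtoC_INR_S. simpl pow. rewrite RtoC_mult.
      replace (B + 1 + RtoC (INR r)) with (B + (RtoC (INR r) + 1)) by ring.
      replace (x + 1 + 1 + RtoC (INR r)) with (x + 1 + (RtoC (INR r) + 1)) by ring.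
      toC; ring.
Qed.

(** * Reduction of the double series *)

(** As both arguments equal 1/2, their powers depend on m + n only, like the factors of [al] and
    [be]; what is left is a Cauchy-product summand. *)
Lemma kdf_term_saal al ep b c be d m n : ~ nonpos_int be -> ~ nonpos_int d ->
  kdf_term [al] [ep] [b; c] [be] [] [d] (RtoC (/ 2)) (RtoC (/ 2)) m n =
  poch al (m + n) / poch be (m + n) * RtoC (/ 2) ^ (m + n) * (saal_p b c d n * saal_q ep m).
Proof.
  intros Hbe Hd. unfold kdf_term, saal_p, saal_q. simpl poch_prod. rewrite Cpow_add_r.
  pose proof (poch_neq_0 be (m + n) Hbe). pose proof (poch_neq_0 d n Hd).
  pose proof (RtoC_fact_neq_0 m). pose proof (RtoC_fact_neq_0 n). field. auto.
Qed.

Lemma kdf_term_geom al ep b c be d : ~ nonpos_int be -> ~ nonpos_int d ->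
  exists M, forall m n,
  (Cmod (kdf_term [al] [ep] [b; c] [be] [] [d] (RtoC (/ 2)) (RtoC (/ 2)) m n)
   <= M * (3 / 4) ^ (m + n))%R.
Proof.
  intros Hbe Hd.
  destruct (poch_ratio_geom al be Hbe) as [M1 [P1 H1]].
  destruct (saal_p_geom b c d Hd) as [M2 [P2 H2]].
  destruct (poch_fact_geom ep) as [M3 [P3 H3]].
  exists (M1 * (M2 * M3))%R. intros m n.
  rewrite kdf_term_saal, !Cmod_mult, Cmod_half_pow by trivial.
  specialize (H1 (m + n)%nat). specialize (H2 n). specialize (H3 m). fold (saal_q ep m) in H3.
  assert (Q : forall q k, (0 < q)%R -> (0 <= q ^ k)%R) by (intros; apply pow_le; lra).
  assert (L : ((121 / 100) ^ n * (11 / 10) ^ m <= (121 / 100) ^ (m + n))%R).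
  { rewrite pow_add, Rmult_comm. apply Rmult_le_compat_r; [apply Q; lra|].
    apply pow_incr; lra. }
  assert (L2 : ((11 / 10) ^ (m + n) * (/ 2) ^ (m + n) * (121 / 100) ^ (m + n)
                <= (3 / 4) ^ (m + n))%R)
    by (rewrite <- !Rpow_mult_distr; apply pow_incr; lra).
  apply Rle_trans with (M1 * (11 / 10) ^ (m + n) * (/ 2) ^ (m + n)
    * (M2 * (121 / 100) ^ n * (M3 * (11 / 10) ^ m)))%R.
  - apply Rmult_le_compat.
    + apply Rmult_le_pos; [apply Cmod_ge_0 | apply Q; lra].
    + apply Rmult_le_pos; apply Cmod_ge_0.
    + apply Rmult_le_compat_r; trivial. apply Q; lra.
    + apply Rmult_le_compat; trivial; apply Cmod_ge_0.
  - replace (M1 * (11 / 10) ^ (m + n) * (/ 2) ^ (m + n)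
      * (M2 * (121 / 100) ^ n * (M3 * (11 / 10) ^ m)))%R
      with (M1 * (M2 * M3) * ((11 / 10) ^ (m + n) * (/ 2) ^ (m + n)
              * ((121 / 100) ^ n * (11 / 10) ^ m)))%R by ring.
    apply Rmult_le_compat_l; [now repeat apply Rmult_le_pos|].
    eapply Rle_trans; [|exact L2]. apply Rmult_le_compat_l; trivial.
    apply Rmult_le_pos; apply Q; lra.
Qed.

(* Summing along the antidiagonals m + n = N, the inner sum is Saalschützian. *)
Lemma kdf_reduction al b c d L : ~ nonpos_int (d - c) -> ~ nonpos_int d ->
  kdf_converges_to [al] [d - b - c] [b; c] [d - c] [] [d] (RtoC (/ 2)) (RtoC (/ 2)) L ->
  L = Gamma d * Hyp al (d - b) d.
Proof.
  intros Hbe Hd HL.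
  set (K := kdf_term [al] [d - b - c] [b; c] [d - c] [] [d] (RtoC (/ 2)) (RtoC (/ 2))).
  destruct (kdf_term_geom al (d - b - c) b c (d - c) d Hbe Hd) as [M HM]. fold K in HM.
  (* The joint limit is taken along square partial sums, with the order of summation exchanged so
     that the index of [saal_p] is the outer one. *)
  assert (H1 : Clim (fun n => sum_n (fun i => sum_n (fun j => K j i) n) n) L).
  { apply Clim_filterlim.
    apply filterlim_ext with (fun n => kdf_partial [al] [d - b - c] [b; c] [d - c] [] [d]
      (RtoC (/ 2)) (RtoC (/ 2)) (n, n)).
    - intros n. unfold kdf_partial. fold K. simpl.
      exact (sum_n_switch K n n).
    - eapply filterlim_comp; [|exact HL].
      apply filterlim_pair; apply filterlim_id. }
  apply square_to_triangle with (M := M) in H1;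
    [|intros i j; rewrite Nat.add_comm; apply HM].
  apply Cser_unique with (2 := saal_p_series al (d - b) d Hd).
  eapply Cser_ext; [|exact H1]. intros n. cbv beta.
  rewrite (Csum_ext _ (fun i => poch al n / poch (d - c) n * RtoC (/ 2) ^ n
    * (saal_p b c d i * saal_q (d - b - c) (n - i)))).
  (* The factor (d - c)_n in the Saalschütz value cancels the denominator, whose parameter is also d
     - c. *)
  - rewrite Csum_scal, (pfaff_saalschutz b c d Hd n). unfold saal_p.
    pose proof (poch_neq_0 (d - c) n Hbe). pose proof (poch_neq_0 d n Hd).
    pose proof (RtoC_fact_neq_0 n). toC; field. auto.
  - intros i Hi. unfold K. rewrite kdf_term_saal by trivial.
    now replace (n - i + i)%nat with n by lia.
Qed.

Theorem theorem2 (i : nat) (alpha beta eps : C) :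
  (* first identity *)
  ( let c := 1 + alpha - 2 * beta + eps + RtoC (INR i) in
    let d := 1 + alpha - beta + eps + RtoC (INR i) in
    ~ nonpos_int beta -> ~ nonpos_int d ->
    ~ nonpos_int (beta - eps - RtoC (INR i)) ->
    ~ nonpos_int (1 + alpha - beta + eps + RtoC (INR i)) ->
    ~ nonpos_int (beta - eps) ->
    ~ nonpos_int (1 + alpha - 2 * beta + 2 * eps + RtoC (INR i)) ->
    (forall r : nat, (r <= i)%nat ->
       ~ nonpos_int (eps - beta + (1 + alpha + RtoC (INR i) + RtoC (INR r)) / 2) /\
       ~ nonpos_int ((1 + alpha - RtoC (INR i) + RtoC (INR r)) / 2)) ->
    forall L : C,
    kdf_converges_to [alpha] [eps] [beta - eps; c] [beta] [] [d] (RtoC (/2)) (RtoC (/2)) L ->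
    L = cpow 2 (RtoC (INR i) + alpha - 2 * beta + 2 * eps)
      * Gamma (beta - eps - RtoC (INR i)) * Gamma (1 + alpha - beta + eps + RtoC (INR i))
      / (Gamma (beta - eps) * Gamma (1 + alpha - 2 * beta + 2 * eps + RtoC (INR i)))
      * sum_n (fun r => RtoC ((-1) ^ r) * cbinom i r
                 * Gamma (eps - beta + (1 + alpha + RtoC (INR i) + RtoC (INR r)) / 2)
                 / Gamma ((1 + alpha - RtoC (INR i) + RtoC (INR r)) / 2)) i )
  /\
  (* second identity *)
  ( let c := 1 + alpha - 2 * beta + eps - RtoC (INR i) in
    let d := 1 + alpha - beta + eps - RtoC (INR i) in
    ~ nonpos_int beta -> ~ nonpos_int d ->
    ~ nonpos_int (1 + alpha - beta + eps - RtoC (INR i)) ->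
    ~ nonpos_int (1 + alpha - 2 * beta + 2 * eps - RtoC (INR i)) ->
    (forall r : nat, (r <= i)%nat ->
       ~ nonpos_int (eps - beta + (1 + alpha - RtoC (INR i) + RtoC (INR r)) / 2) /\
       ~ nonpos_int ((1 + alpha - RtoC (INR i) + RtoC (INR r)) / 2)) ->
    forall L : C,
    kdf_converges_to [alpha] [eps] [beta - eps; c] [beta] [] [d] (RtoC (/2)) (RtoC (/2)) L ->
    L = cpow 2 (- RtoC (INR i) + alpha - 2 * beta + 2 * eps)
      * Gamma (1 + alpha - beta + eps - RtoC (INR i))
      / Gamma (1 + alpha - 2 * beta + 2 * eps - RtoC (INR i))
      * sum_n (fun r => cbinom i r
                 * Gamma (eps - beta + (1 + alpha - RtoC (INR i) + RtoC (INR r)) / 2)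
                 / Gamma ((1 + alpha - RtoC (INR i) + RtoC (INR r)) / 2)) i ).
Proof.
  split; intros c d.
  - intros Hbe Hd Hbi _ Hb HB Hr L HL.
    (* Only the separate parameters [[beta]] and [[eps]] are rewritten; [beta - eps] stays intact as
       the parameter b of [kdf_reduction]. *)
    replace beta with (d - c) in HL at 2 by (unfold d, c; ring).
    replace eps with (d - (beta - eps) - c) in HL at 1 by (unfold d, c; ring).
    assert (Hdc : ~ nonpos_int (d - c)) by (replace (d - c) with beta by (unfold d, c; ring); trivial).
    rewrite (kdf_reduction alpha (beta - eps) c d L Hdc Hd HL).
    set (B := 1 + alpha - 2 * beta + 2 * eps + RtoC (INR i)) in *.
    replace (d - (beta - eps)) with B by (unfold d, B; ring).
    (* With x = alpha - i the first parameter becomes [alpha], the third becomes [d], and the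
       Pochhammer symbol is Gamma(beta - eps) / Gamma(beta - eps - i). *)
    pose proof (gauss_second_plus i (alpha - RtoC (INR i)) B HB) as E.
    replace (alpha - RtoC (INR i) + RtoC (INR i)) with alpha in E by ring.
    replace ((alpha - RtoC (INR i) + B + 1) / 2 + RtoC (INR i)) with d in E
      by (unfold d, B; field).
    replace ((alpha - RtoC (INR i) + 1 - B) / 2) with (beta - eps - RtoC (INR i)) in E
      by (unfold B; field).
    replace (B - 1) with (RtoC (INR i) + alpha - 2 * beta + 2 * eps) in E by (unfold B; ring).
    pose proof (Gamma_poch _ i Hbi) as Eb.
    replace (beta - eps - RtoC (INR i) + RtoC (INR i)) with (beta - eps) in Eb by ring.
    rewrite Eb. fold d.
    match goal with |- _ = _ * sum_n ?f i => set (F := f) end.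
    rewrite (Csum_ext _ F) in E.
    + pose proof (Gamma_neq_0 _ HB). pose proof (Gamma_neq_0 _ Hbi).
      pose proof (poch_neq_0 _ i Hbi).
      set (p := poch (beta - eps - RtoC (INR i)) i) in *.
      replace (Hyp alpha B d) with (p * Gamma B * Hyp alpha B d / (p * Gamma B)) by (field; auto).
      rewrite E. toC; field. auto.
    + intros r Hri. destruct (Hr r Hri) as [_ Hr2]. unfold F.
      replace ((alpha - RtoC (INR i) + 1 + RtoC (INR r)) / 2)
        with ((1 + alpha - RtoC (INR i) + RtoC (INR r)) / 2) by field.
      rewrite rG_Gamma by trivial.
      replace ((B + RtoC (INR r)) / 2)
        with (eps - beta + (1 + alpha + RtoC (INR i) + RtoC (INR r)) / 2) by (unfold B; field).
      unfold Cdiv. toC; ring.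
  - intros Hbe Hd _ HB Hr L HL.
    replace beta with (d - c) in HL at 2 by (unfold d, c; ring).
    replace eps with (d - (beta - eps) - c) in HL at 1 by (unfold d, c; ring).
    assert (Hdc : ~ nonpos_int (d - c)) by (replace (d - c) with beta by (unfold d, c; ring); trivial).
    rewrite (kdf_reduction alpha (beta - eps) c d L Hdc Hd HL).
    set (B := 1 + alpha - 2 * beta + 2 * eps - RtoC (INR i)) in *.
    replace (d - (beta - eps)) with B by (unfold d, B; ring).
    pose proof (gauss_second_minus i (alpha - RtoC (INR i)) B HB) as E.
    replace (alpha - RtoC (INR i) + RtoC (INR i)) with alpha in E by ring.
    replace ((alpha - RtoC (INR i) + B + 1) / 2) with d in E by (unfold d, B; field).
    replace (B - 1) with (- RtoC (INR i) + alpha - 2 * beta + 2 * eps) in E by (unfold B; ring).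
    fold d.
    match goal with |- _ = _ * sum_n ?f i => set (F := f) end.
    rewrite (Csum_ext _ F) in E.
    + pose proof (Gamma_neq_0 _ HB).
      replace (Hyp alpha B d) with (Gamma B * Hyp alpha B d / Gamma B) by (field; auto).
      rewrite E. toC; field. auto.
    + intros r Hri. destruct (Hr r Hri) as [_ Hr2]. unfold F.
      replace ((alpha - RtoC (INR i) + 1 + RtoC (INR r)) / 2)
        with ((1 + alpha - RtoC (INR i) + RtoC (INR r)) / 2) by field.
      rewrite rG_Gamma by trivial.
      replace ((B + RtoC (INR r)) / 2)
        with (eps - beta + (1 + alpha - RtoC (INR i) + RtoC (INR r)) / 2) by (unfold B; field).
      unfold Cdiv. toC; ring.
Qed.
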